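(* Let $n\ge 1$ and let $d,e$ be integers with $1\le e<\frac d2$. Let $X\subseteq\mathbb P^N$, $N=\binom{d+n}{d}-1$, be the locus of degree $d$ forms in $n+1$ variables (up to scalars) of the shape $L_1^{d-e}L_2^e$ with $L_1,L_2$ linear forms. For every $r\ge3$, the variety $X$ is $r$-normal, i.e. the restriction morphism $$H^0(\mathbb P^N,\mathcal O_{\mathbb P^N}(r))\longrightarrow H^0(\mathbb P^N,\mathcal O_X(r))$$ is surjective.
   Context: The base field is $\mathbb C$. $\mathbb P^N$ is the projective space of nonzero degree $d$ forms in $x_0,\dots,x_n$ up to scalars, and $$X=\{[F]\in\mathbb P^N: F=L_1^{d-e}L_2^{e}\text{ for some linear forms }L_1,L_2\text{ in }x_0,\dots,x_n\},$$ regarded as a closed (reduced) subvariety with structure sheaf $\mathcal O_X$. *)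

(* Defs.v *)
From HB Require Import structures.
From mathcomp Require Import all_boot all_order all_algebra.
From mathcomp Require Export mpoly.

Set Implicit Arguments.
Unset Strict Implicit.
Unset Printing Implicit Defensive.

Import GRing.Theory.
Local Open Scope ring_scope.

(* A point of P^N over K is given by its homogeneous coordinates, i.e. by a
   nonzero row vector of length N + 1 up to scaling.  A subset of P^N is a
   predicate on coordinate vectors that holds only at nonzero vectors and is
   invariant under nonzero scalars (the punctured affine cone). *)
Section ProjectiveSpace.
Variables (K : fieldType) (N : nat).

Definition pspace (v : 'rV[K]_N.+1) : Prop := v != 0.

Definition heval (G : {mpoly K[N.+1]}) (v : 'rV[K]_N.+1) : K := G.@[v ord0].

Definition zariski_open (U : 'rV[K]_N.+1 -> Prop) : Prop :=
  exists E : {mpoly K[N.+1]} -> Prop,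
    (forall P, E P -> exists k, P \is k.-homog) /\
    (forall v, pspace v -> (U v <-> exists2 P, E P & heval P v != 0)).

(* H^0(P^N, O_X(r)) for a closed subset X with its reduced structure, K being
   algebraically closed: a section is a function on the punctured affine cone
   over X, homogeneous of degree r, which Zariski-locally on X is a quotient
   G / H of homogeneous polynomials with deg G - deg H = r and H nowhere zero.
   Two functions define the same section when they agree on X; the values
   outside X are irrelevant. *)
Definition twisted_section (X : 'rV[K]_N.+1 -> Prop) (r : nat)
    (s : 'rV[K]_N.+1 -> K) : Prop :=
  (forall (c : K) v, c != 0 -> X v -> s (c *: v) = c ^+ r * s v) /\
  (forall p, X p -> exists U : 'rV[K]_N.+1 -> Prop,
    [/\ zariski_open U, U p
      & exists (k : nat) (G H : {mpoly K[N.+1]}),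
        [/\ G \is (k + r).-homog, H \is k.-homog
          & forall q, X q -> U q ->
              heval H q != 0 /\ s q = heval G q / heval H q]]).

(* Surjectivity of the restriction H^0(P^N, O(r)) -> H^0(P^N, O_X(r)). *)
Definition r_normal (X : 'rV[K]_N.+1 -> Prop) (r : nat) : Prop :=
  forall s, twisted_section X r s ->
    exists t, twisted_section pspace r t /\ (forall v, X v -> t v = s v).

End ProjectiveSpace.

Section FormsOfDegree.
Variables (K : fieldType) (n d : nat).

Definition formsN : nat := ('C(d + n, d) - 1)%N.

(* All the monomials of degree d in n + 1 variables, each listed once
   (basis_cover, uniq_basis); by size_basis there are formsN + 1 of them. *)
Definition form_monomials : seq 'X_{1..n.+1} :=
  [seq s2m t | t : d.-tuple 'I_n.+1 <- enum (basis n.+1 d)].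

Definition form_coords (F : {mpoly K[n.+1]}) : 'rV[K]_formsN.+1 :=
  \row_(i < formsN.+1) F@_(nth 0%MM form_monomials i).

(* The scalar c only expresses that points of P^N are forms up to scalars. *)
Definition two_power_locus (e : nat) (v : 'rV[K]_formsN.+1) : Prop :=
  v != 0 /\
  exists (L1 L2 : {mpoly K[n.+1]}) (c : K),
    [/\ L1 \is 1.-homog, L2 \is 1.-homog
      & v = c *: form_coords (L1 ^+ (d - e) * L2 ^+ e)].

Lemma size_form_monomials : size form_monomials = formsN.+1.
Proof. by rewrite size_basis /formsN subn1 prednK // bin_gt0 leq_addr. Qed.

End FormsOfDegree.

Arguments two_power_locus : clear implicits.

(* Main.v *)
From Stdlib Require Import FunctionalExtensionality.
Require Import Defs.
From mathcomp Require Import all_boot all_order all_algebra.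
From mathcomp Require Import reals complex.
From mathcomp Require Import ring lra zify.

(* Write A = d - e, B = e and let (a, b) be the coefficient vectors of
   (L_1, L_2).  A section of O_X(r) pulls back to a function of (a, b) that is a
   bihomogeneous polynomial f of bidegree (rA, rB).  The coordinates of
   L_1^A L_2^B have zero derivative at the diagonal points (c, c) in the
   directions (B m, - A m), hence so does f: X is cuspidal along the diagonal.

   By the Clebsch-Gordan series, bihomogeneous forms of bidegree (rA, rB) are
   spanned by the D^p (a.x)^(rA - p) (b.x)^(rB - p), p <= rB, where
   D = (a.x)(b.y) - (a.y)(b.x), and the derivative condition kills exactly the
   summand p = 1.  The other summands are degree r polynomials in the
   coordinates: if the summands p1 in degree r1 and p2 in degree r2 are, then
   applying the j-th power of Cayley's Omega operator to the product of their
   spanning families at x1 and x2 and setting x1 = x2 yields the summand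
   p1 + p2 + j in degree r1 + r2, up to an explicit constant kappa.  Starting
   from r = 1, p = 0, nonzero constants lead to every p <> 1 as soon as r >= 3;
   the even p in degree 2 come from the fact that kappa is then, up to sign, a
   sum of squares. *)

Set Implicit Arguments.
Unset Strict Implicit.
Unset Printing Implicit Defensive.

Import Order.TTheory GRing.Theory Num.Theory.
Local Open Scope ring_scope.

(** * Univariate polynomials *)

Lemma coef_pencil (R : comNzRingType) (u v : R) a i :
  ((u%:P + v%:P * 'X) ^+ a : {poly R})`_i = u ^+ (a - i) * v ^+ i *+ 'C(a, i).
Proof.
rewrite exprDn coef_sum.
have E (l : 'I_a.+1) : (u%:P ^+ (a - l) * (v%:P * 'X) ^+ l *+ 'C(a, l) : {poly R})`_i =
    (u ^+ (a - l) * v ^+ l * (i == l)%:R) *+ 'C(a, l).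
  by rewrite coefMn exprMn -!polyC_exp mulrA -polyCM coefCM coefXn.
under eq_bigr => l _ do rewrite E.
have [ai|ia] := ltnP a i.
  rewrite bin_small // mulr0n big1 // => l _.
  by rewrite gtn_eqF ?mulr0 ?mul0rn // (leq_ltn_trans _ ai) // -ltnS.
rewrite (bigD1 (Ordinal (ia : (i < a.+1)%N))) //= eqxx mulr1 big1 ?addr0 // => l li.
case: eqP => [e|_]; last by rewrite mulr0 mul0rn.
by case/eqP: li; apply: val_inj.
Qed.

Section Univariate.
Variable K : numFieldType.
Implicit Types p q : {poly K}.

(** In characteristic 0 the naturals are distinct, so [(p - q) * Z], which vanishes at all of them,
    would have too many roots. *)
Lemma poly_eq_off_roots p q (Z : {poly K}) : Z != 0 ->
  (forall t, Z.[t] != 0 -> p.[t] = q.[t]) -> p = q.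
Proof.
move=> Z0 pq; apply/eqP; rewrite -subr_eq0; apply/negPn/negP => pq0.
have h0 : (p - q) * Z != 0 by rewrite mulf_neq0.
have := @max_poly_roots _ ((p - q) * Z)
  [seq i%:R | i <- iota 0 (size ((p - q) * Z)%R)] h0.
rewrite size_map size_iota ltnn => H; suff: false by []; apply: H.
- apply/allP => t /mapP [i _ ->]; rewrite /root hornerM hornerD hornerN.
  by have [->|/pq->] := eqVneq Z.[i%:R] 0; rewrite ?mulr0 // subrr mul0r.
- rewrite map_inj_uniq ?iota_uniq // => i j /eqP.
  by rewrite eqr_nat => /eqP.
Qed.

Lemma poly_ext_neq0 p q : (forall t, t != 0 -> p.[t] = q.[t]) -> p = q.
Proof.
by move=> pq; apply: (@poly_eq_off_roots _ _ 'X); rewrite ?polyX_eq0 // => t;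
  rewrite hornerX => /pq.
Qed.

(** The Lagrange basis for the nodes 0, ..., N - 1, which are distinct in characteristic 0. *)
Definition lagr N (i : 'I_N) : {poly K} :=
  \prod_(j < N | j != i) ((i%:R - j%:R)^-1 *: ('X - j%:R%:P)).

Lemma size_lagr N (i : 'I_N) : (size (lagr i) <= N)%N.
Proof.
have cN : (#|[pred j : 'I_N | j != i]|.+1 = N)%N.
  by rewrite -[RHS]card_ord [RHS](cardD1 i) inE add1n; congr _.+1;
    apply: eq_card => j; rewrite !inE andbT.
apply: leq_trans (size_poly_prod_leq _ _) _; rewrite leq_subLR.
have H : (\sum_(j < N | j != i) size ((i%:R - j%:R)^-1 *: ('X - j%:R%:P : {poly K})) <= \sum_(j < N | j != i) 2)%N.
  apply: leq_sum => j ji.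
  by rewrite (leq_trans (size_scale_leq _ _)) // size_XsubC.
by apply: leq_ltn_trans H _; rewrite sum_nat_const; move: cN; set c := #|_|; lia.
Qed.

Lemma lagrE N (i k : 'I_N) : (lagr i).[k%:R] = (i == k)%:R.
Proof.
rewrite /lagr horner_prod; have [<-|ik] := eqVneq i k.
  apply: big1 => j ji; rewrite hornerZ hornerXsubC mulVf // subr_eq0 eqr_nat.
  by apply: contra ji => /eqP/val_inj->.
by rewrite (bigD1 k) 1?eq_sym //= hornerZ hornerXsubC subrr mulr0 mul0r.
Qed.

Lemma lagrange_interpolation N p : (size p <= N)%N ->
  p = \sum_(i < N) p.[i%:R] *: lagr i.
Proof.
move=> sp; apply/eqP; rewrite -subr_eq0; apply/negPn/negP => h0.
set h := p - _ in h0.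
have sh : (size h <= N)%N.
  rewrite (leq_trans (size_polyD _ _)) // geq_max sp size_polyN.
  apply: (leq_trans (size_sum _ _ _)); apply/bigmax_leqP => i _.
  by rewrite (leq_trans (size_scale_leq _ _)) // size_lagr.
have := @max_poly_roots _ h [seq i%:R | i <- iota 0 N] h0.
rewrite size_map size_iota ltnNge sh => H; suff: false by []; apply: H.
- apply/allP => t /mapP [k]; rewrite mem_iota add0n => /= kN ->.
  rewrite /root hornerD hornerN horner_sum (bigD1 (Ordinal kN)) //=.
  rewrite hornerZ (lagrE _ (Ordinal kN)) eqxx mulr1 big1 ?addr0 ?subrr // => j ji.
  by rewrite hornerZ (lagrE _ (Ordinal kN)) (negbTE ji) mulr0.
- rewrite map_inj_uniq ?iota_uniq // => i j /eqP.
  by rewrite eqr_nat => /eqP.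
Qed.

(** The weights do not depend on [p]: extracting a coefficient becomes a fixed linear combination of
    values, so it preserves linear subspaces. *)
Lemma coef_from_values N p k : (size p <= N)%N ->
  p`_k = \sum_(i < N) (lagr i)`_k * p.[i%:R].
Proof.
move=> /lagrange_interpolation {1}->; rewrite coef_sum.
by apply: eq_bigr => i _; rewrite coefZ mulrC.
Qed.

End Univariate.

(** * Locally rational functions of one variable *)

Section LocallyRational.
Variable K : numClosedFieldType.

(* In lowest terms, the denominator of a local expression has no root: at a
   root, the expression valid there would allow cancelling a common factor. *)
Lemma locally_rational_polynomial (g : K -> K) :
  (forall t0, exists Z G H : {poly K}, Z.[t0] != 0 /\
     forall t, Z.[t] != 0 -> H.[t] != 0 /\ g t * H.[t] = G.[t]) ->
  exists p : {poly K}, forall t, g t = p.[t].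
Proof.
move=> loc.
(* Agreement off finitely many points suffices: the expression [G / H] valid at [t] then satisfies
   [p * H = G] as polynomials, and [H.[t]] is nonzero. *)
suff [p [Z [Z0 gp]]] : exists p Z : {poly K}, Z != 0 /\
    forall t, Z.[t] != 0 -> g t = p.[t].
  exists p => t; have [Z' [G [H [Z't gG]]]] := loc t.
  have [Ht e] := gG _ Z't.
  have Z'0 : Z' != 0 by apply: contraNneq Z't => ->; rewrite horner0.
  have /(congr1 (horner^~ t)) : p * H = G.
    apply: (@poly_eq_off_roots _ _ _ (Z * Z')); rewrite ?mulf_neq0 // => u.
    rewrite hornerM mulf_eq0 negb_or => /andP [/gp e' /gG [_ <-]].
    by rewrite hornerM e'.
  by rewrite /= hornerM -e => /(mulIf Ht).
(* Only a generic identity is kept; the induction is on the bound [n] for the size of its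
   denominator. *)
have [n [Z [G [H [Z0 H0 sH gG]]]]] : exists n (Z G H : {poly K}),
    [/\ Z != 0, H != 0, (size H <= n)%N &
        forall t, Z.[t] != 0 -> g t * H.[t] = G.[t]].
  have [Z [G [H [Z0 gG]]]] := loc 0; exists (size H), Z, G, H; split=> //.
  - by apply: contraNneq Z0 => ->; rewrite horner0.
  - by have [h _] := gG _ Z0; apply: contraNneq h => ->; rewrite horner0.
  - by move=> t /gG [].
elim: n => [|n IHn] in Z G H Z0 H0 sH gG *.
  by move: sH H0; rewrite leqn0 size_poly_eq0 => ->.
have [/closed_rootP|/negPn sH1] := boolP (size H != 1%N); last first.
  have /size_poly1P [c c0 Hc] := sH1.
  exists (c^-1 *: G), Z; split=> // t /gG; rewrite Hc hornerZ hornerC => <-.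
  by rewrite mulrCA mulVf // mulr1.
move=> [t1 /[dup] Ht1 /factor_theorem [H' HH']].
have [Z1 [G1 [H1 [Z1t gG1]]]] := loc t1.
have Z10 : Z1 != 0 by apply: contraNneq Z1t => ->; rewrite horner0.
have [H1t _] := gG1 _ Z1t.
have E : G * H1 = G1 * H.
  apply: (@poly_eq_off_roots _ _ _ (Z * Z1)); rewrite ?mulf_neq0 // => u.
  rewrite hornerM mulf_eq0 negb_or => /andP [/gG e /gG1 [_ e1]].
  by rewrite !hornerM -e -e1 mulrAC.
have /factor_theorem [G' GG'] : root G t1.
  have /eqP := congr1 (horner^~ t1) E.
  by rewrite !hornerM (eqP Ht1) mulr0 mulf_eq0 (negbTE H1t) orbF.
have H'0 : H' != 0 by apply: contraNneq H0 => h; rewrite HH' h mul0r.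
(* Excluding [t1] as well allows the common factor to be cancelled pointwise. *)
apply: (IHn (Z * ('X - t1%:P)) G' H'); rewrite ?mulf_neq0 ?polyXsubC_eq0 //.
  by move: sH; rewrite HH' size_Mmonic ?monicXsubC // size_XsubC addn2.
move=> t; rewrite hornerM mulf_eq0 negb_or => /andP [/gG + h].
by rewrite HH' GG' !hornerM mulrA => /(mulIf h).
Qed.

End LocallyRational.

(** * Transvectant constants *)

(** The scalar produced by j applications of Omega to a product of powers of two linear forms, with
    exponents [a], [b] at the first point and [c], [d] at the second. Truncated predecessors are
    harmless, since a zero exponent makes its term vanish. *)
Fixpoint kappa (j a b c d : nat) : int :=
  if j is j'.+1 then
    (a * d)%:Z * kappa j' a.-1 b c d.-1 - (b * c)%:Z * kappa j' a b.-1 c.-1 d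
  else 1.

Definition kappa_term (a b c d k l : nat) : int :=
  (a ^_ k * d ^_ k * b ^_ l * c ^_ l)%N%:Z.

(** The two terms of the recursion lower disjoint pairs of arguments, hence commute, and a binomial
    expansion results; the induction is Pascal's rule. *)
Lemma kappaE j a b c d : kappa j a b c d =
  \sum_(i < j.+1) (-1) ^+ i * 'C(j, i)%:Z * kappa_term a b c d (j - i) i.
Proof.
elim: j a b c d => [|j IHj] a b c d.
  by rewrite big_ord_recr big_ord0 /= /kappa_term !ffactn0 bin0 !mulr1 add0r.
have E1 : (a * d)%:Z * kappa j a.-1 b c d.-1 =
    \sum_(i < j.+2) (-1) ^+ i * 'C(j, i)%:Z * kappa_term a b c d (j.+1 - i) i.
  rewrite IHj mulr_sumr [RHS]big_ord_recr /= bin_small // mulr0 mul0r addr0.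
  apply: eq_bigr => i _; rewrite subSn; last by rewrite -ltnS.
  rewrite /kappa_term !ffactnS !PoszM.
  by ring.
have E2 : - ((b * c)%:Z * kappa j a b.-1 c.-1 d) =
    \sum_(i < j.+2) (-1) ^+ i * (if val i is i'.+1 then 'C(j, i')%:Z else 0)
       * kappa_term a b c d (j.+1 - i) i.
  rewrite IHj mulr_sumr -sumrN [RHS]big_ord_recl /= mulr0 mul0r add0r.
  apply: eq_bigr => i _; rewrite /bump /= add1n subSS /kappa_term !ffactnS !PoszM.
  by rewrite exprS; ring.
rewrite /= E1 E2 -big_split; apply: eq_bigr => -[[|i] /= i_le] _.
  by rewrite !bin0; ring.
by rewrite binS PoszD; ring.
Qed.

Lemma coef_1DXn (R : comNzRingType) b k : ((1 + 'X) ^+ b : {poly R})`_k = 'C(b, k)%:R.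
Proof. by rewrite -[1]polyC1 -['X]mul1r -polyC1 coef_pencil !expr1n mulr1. Qed.

(** * Nonvanishing of the even constants *)

Section EvenTransvectant.

(** The coefficient of x^k in x^j (1 + x)^a. *)
Let shifted_bin (j a k : nat) : int := if (k < j)%N then 0 else 'C(a, k - j)%:Z.

(** This is (x - y)^m (1 + x)^a (1 + y)^b, with x the inner and y the outer variable. *)
Let W (m a b : nat) : {poly {poly int}} :=
  ('X%:P - 'X) ^+ m * ((1 + 'X) ^+ a)%:P * (1 + 'X) ^+ b.

Let coefW m a b k l : (W m a b)`_l`_k = \sum_(i < m.+1)
  (-1) ^+ i * 'C(m, i)%:Z * (shifted_bin (m - i) a k * shifted_bin i b l).
Proof.
rewrite /W exprBn !mulr_suml !coef_sum; apply: eq_bigr => i _.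
have -> : ((-1) ^+ i * 'X%:P ^+ (m - i) * 'X ^+ i) *+ 'C(m, i) *
      ((1 + 'X) ^+ a)%:P * (1 + 'X) ^+ b =
    (((-1) ^+ i * 'C(m, i)%:R)%:P * ('X^(m - i) * (1 + 'X) ^+ a))%:P *
    ('X^i * (1 + 'X) ^+ b) :> {poly {poly int}}.
  rewrite !rmorphM /= !rmorphXn /= !rmorphN /= !rmorph1 !rmorph_nat /= -mulr_natl.
  by ring.
rewrite coefCM.
have -> : ('X^i * (1 + 'X) ^+ b : {poly {poly int}})`_l = (shifted_bin i b l)%:P.
  by rewrite coefXnM coef_1DXn /shifted_bin; case: ifP; rewrite ?polyC0 // -natz rmorph_nat.
rewrite coefMC coefCM coefXnM coef_1DXn !mulrA natz.
by rewrite /shifted_bin; case: ifP; rewrite // natz.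
Qed.

(** Inverting x and y and clearing denominators fixes the powers of 1 + x and 1 + y and turns (x -
    y)^m into (y - x)^m. *)
Let W_sym m a b k l : (k <= m + a)%N -> (l <= m + b)%N ->
  (W m a b)`_(m + b - l)`_(m + a - k) = (-1) ^+ m * (W m a b)`_l`_k.
Proof.
move=> ka lb; rewrite !coefW mulr_sumr (reindex_inj rev_ord_inj) /=.
have E j c n : (j <= m)%N -> (n <= m + c)%N ->
    shifted_bin (m - j) c (m + c - n) = shifted_bin j c n.
  move=> jm nc; rewrite /shifted_bin; case: ltnP => h1; case: ltnP => h2 //.
  - by rewrite bin_small //; lia.
  - by rewrite bin_small //; lia.
  - by rewrite -bin_sub; [congr ('C(_, _)%:Z); lia | lia].
apply: eq_bigr => i _; have im : (i <= m)%N by rewrite -ltnS.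
rewrite subSS (E (m - i)%N) ?leq_subr // (E i) // bin_sub // !mulrA.
by congr (_ * _ * _ * _); rewrite -signr_odd oddB // signr_addb !signr_odd.
Qed.

(* [kappa] is, up to factorials, the coefficient of [x^A y^B] in the square of
   [W], which by [W_sym] is [(-1)^m] times the sum of the squared coefficients
   of [W]. *)
Lemma kappa_even_neq0 m A B : (m <= A)%N -> (m <= B)%N ->
  kappa m.*2 A B A B != 0.
Proof.
move=> mA mB.
pose w := W m (A - m) (B - m).
have ww : w * w = W m.*2 (A.*2 - m.*2) (B.*2 - m.*2).
  rewrite /w /W -!doubleB -!addnn !exprD !rmorphM /=; ring.
(* The exponent (A, B) is the centre of the square, so each product in the convolution pairs a
   coefficient with its mirror image. *)
have wW : (w * w)`_B`_A = (-1) ^+ m * \sum_(l < B.+1) \sum_(k < A.+1) w`_l`_k ^+ 2.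
  rewrite coefM coef_sum mulr_sumr; apply: eq_bigr => l _.
  rewrite coefM mulr_sumr; apply: eq_bigr => k _.
  have := @W_sym m (A - m) (B - m) k l; rewrite !subnKC // -/w => -> //.
  - by rewrite mulrCA expr2.
  - by rewrite -ltnS.
  - by rewrite -ltnS.
have pos : 0 < \sum_(l < B.+1) \sum_(k < A.+1) w`_l`_k ^+ 2.
  have wm : w`_0`_m = 1.
    rewrite coefW big_ord_recl big1 ?addr0.
      by rewrite /= bin0 subn0 /shifted_bin !ltnn !subnn !bin0.
    by move=> i _; rewrite /shifted_bin /bump /= !mulr0.
  rewrite (bigD1 ord0) //= (bigD1 (Ordinal (mA : (m < A.+1)%N))) //= wm.
  rewrite -addrA ltr_pwDl ?addr_ge0 //; try exact: sumr_ge0.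
    by apply: sumr_ge0 => i _; apply: sqr_ge0.
  by apply: sumr_ge0 => i _; apply: sumr_ge0 => k _; apply: sqr_ge0.
move/(congr1 (fun p : {poly {poly int}} => p`_B`_A)): ww; rewrite wW coefW => E.
(* Multiplying by factorials turns the shifted binomials into the falling factorials of
   [kappa_term]. *)
have H j n : (j <= m.*2)%N -> (m <= n)%N ->
    shifted_bin (m.*2 - j) (n.*2 - m.*2) n * (n`! * n`!)%N%:Z =
    (n ^_ j * n ^_ (m.*2 - j) * (n.*2 - m.*2)`!)%N%:Z.
  move=> jm mn; rewrite /shifted_bin; case: ltnP => h1.
    by rewrite [(n ^_ (m.*2 - j))%N]ffact_small // muln0 mul0n mul0r.
  have [h2|h2] := ltnP n j.
    by rewrite bin_small ?[(n ^_ j)%N]ffact_small //; lia.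
  rewrite -PoszM; congr Posz.
  have e1 := ffact_fact h1; have e2 := ffact_fact h2.
  have h3 : (n - (m.*2 - j) <= n.*2 - m.*2)%N by lia.
  have e3 := bin_fact h3.
  have e4 : (n.*2 - m.*2 - (n - (m.*2 - j)) = n - j)%N by lia.
  rewrite e4 in e3; rewrite -e3 -{1}e1 -e2; ring.
have {E} : kappa m.*2 A B A B * ((A.*2 - m.*2)`! * (B.*2 - m.*2)`!)%N%:Z =
   ((-1) ^+ m * \sum_(l < B.+1) \sum_(k < A.+1) w`_l`_k ^+ 2) *
   ((A`! * A`!) * (B`! * B`!))%N%:Z.
  rewrite E kappaE !mulr_suml; apply: eq_bigr => i _.
  have im : (i <= m.*2)%N by rewrite -ltnS.
  have := H _ A im mA; have := H (m.*2 - i)%N B (leq_subr _ _) mB.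
  rewrite subKn // !PoszM /kappa_term !PoszM => e1 e2.
  transitivity ((-1) ^+ i * 'C(m.*2, i)%:Z * (
    (shifted_bin (m.*2 - i) (A.*2 - m.*2) A * (A`! * A`!)%N%:Z) *
    (shifted_bin i (B.*2 - m.*2) B * (B`! * B`!)%N%:Z))); last by rewrite !PoszM; ring.
  by rewrite !PoszM e1 e2; ring.
move=> E; apply/eqP => k0; move/eqP: E; rewrite k0 mul0r eq_sym !mulf_eq0.
by rewrite signr_eq0 gt_eqF // eqz_nat !muln_eq0 !gtn_eqF ?fact_gt0.
Qed.

End EvenTransvectant.

(** With [b = 0] only the term [i = 0] of [kappaE] survives. *)
Lemma kappa_first a c d j : (j <= a)%N -> (j <= d)%N -> kappa j a 0 c d != 0.
Proof.
move=> ja jd; rewrite kappaE big_ord_recl big1 ?addr0 /=; last first.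
  by move=> i _; rewrite /kappa_term /bump /= ffact0n muln0 mul0n mulr0.
rewrite bin0 subn0 /kappa_term !ffactn0 !mul1r !muln1 eqz_nat.
by rewrite muln_eq0 !gtn_eqF ?ffact_gt0.
Qed.

(** The falling factorials of [a] and [b] leave only the term [i = b]. *)
Lemma kappa_extreme a b c d : (a <= d)%N -> (b <= c)%N -> kappa (a + b) a b c d != 0.
Proof.
move=> ad bc; have bj : (b < (a + b).+1)%N by lia.
rewrite kappaE (bigD1 (Ordinal bj)) //= big1 ?addr0; last first.
  move=> i /eqP ib; rewrite /kappa_term.
  have [h|h] := ltnP b i; first by rewrite [(b ^_ _)%N]ffact_small // muln0 mul0n mulr0.
  rewrite [(a ^_ _)%N]ffact_small ?mul0n ?mulr0 //.
  suff : i != b :> nat by lia.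
  by apply/eqP => e; apply: ib; apply: val_inj.
rewrite addnK !mulf_neq0 ?signr_eq0 // eqz_nat.
  by rewrite gtn_eqF // bin_gt0 leq_addl.
by rewrite !muln_eq0 !gtn_eqF ?ffact_gt0.
Qed.

(** Only the terms [i = b - 1] and [i = b] survive, with opposite signs. Up to common factors,
    equality of their sizes would mean b (d + 1 - a) = a (c + 1 - b), but the left side is
    smaller. *)
Lemma kappa_subextreme a b c d : (b < a)%N -> (0 < b)%N -> (b <= c)%N ->
  (a <= d.+1)%N -> (d + b < c + a)%N -> kappa (a + b).-1 a b c d != 0.
Proof.
case: a b => [//|a] [//|b] ba _ bc ad dc.
rewrite (_ : (a.+1 + b.+1).-1 = (a + b).+1)%N; last by lia.
have b1 : (b < (a + b).+2)%N by lia.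
have b2 : (b.+1 < (a + b).+2)%N by lia.
rewrite kappaE (bigD1 (Ordinal b1)) //= (bigD1 (Ordinal b2)) //=; last first.
  by apply/eqP => -[]; lia.
rewrite big1 ?addr0; last first.
  move=> i /andP [/eqP i1 /eqP i2]; rewrite /kappa_term.
  have [h|h] := ltnP b.+1 i.
    by rewrite [(b.+1 ^_ _)%N]ffact_small // muln0 mul0n mulr0.
  rewrite [(a.+1 ^_ _)%N]ffact_small ?mul0n ?mulr0 //.
  have : i != b :> nat by apply/eqP => e; apply: i1; apply: val_inj.
  have : i != b.+1 :> nat by apply/eqP => e; apply: i2; apply: val_inj.
  by lia.
have -> : ((a + b).+1 - b = a.+1)%N by lia.
have -> : ((a + b).+1 - b.+1 = a)%N by lia.
rewrite exprS mulN1r !mulNr -!mulrA -mulrBr mulf_neq0 ?signr_eq0 //.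
rewrite subr_eq0 -!PoszM eqz_nat /kappa_term.
have e1 := mul_bin_left (a + b).+1 b.
rewrite (_ : ((a + b).+1 - b = a.+1)%N) in e1; last by lia.
apply/eqP => E.
have := congr1 (muln b.+1) E.
rewrite [in RHS]mulnA e1.
rewrite (ffactnSr a.+1 a) (ffactnSr b.+1 b) (ffactnSr d a) (ffactnSr c b).
rewrite !subSnn !muln1.
set C := 'C(_, b); set Z := (a.+1 ^_ a * d ^_ a * b.+1 ^_ b * c ^_ b)%N.
have C0 : (0 < C)%N by rewrite bin_gt0; lia.
have Z0 : (0 < Z)%N by rewrite !muln_gt0 !ffact_gt0; lia.
move=> E2.
have {}E2 : ((C * Z) * (b.+1 * (d - a)) = (C * Z) * (a.+1 * (c - b)))%N.
  by rewrite /Z; lia.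
have CZ : (0 < C * Z)%N by rewrite muln_gt0 C0.
move/eqP: E2; rewrite eqn_pmul2l //.
have : (b.+1 * (d - a) < a.+1 * (c - b))%N.
  apply: leq_ltn_trans (_ : (_ <= a.+1 * (d - a))%N) _; first by rewrite leq_mul2r; lia.
  by rewrite ltn_mul2l; lia.
by move=> h /eqP E2; rewrite E2 ltnn in h.
Qed.

(* [G r p] stands for: the [p]-th summand of [Sym^(rA) * Sym^(rB)] lies in the
   image of [Sym^r (Sym^d)]. *)
Lemma reachable_transvectants (A B : nat) (G : nat -> nat -> Prop) :
  (0 < B)%N -> (B < A)%N -> G 1%N 0%N ->
  (forall r1 p1 r2 p2 j, (p1 <= r1 * B)%N -> (p2 <= r2 * B)%N ->
     G r1 p1 -> G r2 p2 ->
     kappa j (r1 * A - p1) (r1 * B - p1) (r2 * A - p2) (r2 * B - p2) != 0 ->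
     G (r1 + r2)%N (p1 + p2 + j)%N) ->
  forall r p, (3 <= r)%N -> (p <= r * B)%N -> p != 1%N -> G r p.
Proof.
move=> B0 BA G10 GT.
have G2 m : (m <= B)%N -> G 2%N m.*2.
  move=> mB; apply: (GT 1%N 0%N 1%N 0%N m.*2) => //.
  by rewrite !mul1n !subn0 kappa_even_neq0 //; lia.
have G2e q : (q <= 2 * B)%N -> ~~ odd q -> G 2%N q.
  by move=> qB /even_halfK <-; apply: G2; lia.
(* The case [j = 0], where [kappa] is 1. *)
have GM r1 p1 r2 p2 : (p1 <= r1 * B)%N -> (p2 <= r2 * B)%N ->
    G r1 p1 -> G r2 p2 -> G (r1 + r2)%N (p1 + p2)%N.
  by move=> h1 h2 g1 g2; rewrite -[(p1 + p2)%N]addn0; apply: GT.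
(* For [j = 1], [kappa] equals (A - B) (r2 p1 - r1 p2). *)
have GJ r1 p1 r2 p2 : (p1 <= r1 * B)%N -> (p2 <= r2 * B)%N ->
    G r1 p1 -> G r2 p2 -> (r2 * p1 != r1 * p2)%N -> G (r1 + r2)%N (p1 + p2 + 1)%N.
  move=> h1 h2 g1 g2 ne; apply: GT => //=; rewrite !mulr1.
  have l1 : (p1 <= r1 * A)%N by nia.
  have l2 : (p2 <= r2 * A)%N by nia.
  rewrite subr_eq0; apply: contra ne => /eqP; rewrite !PoszM -!subzn // !PoszM.
  move=> E; have : (A%:Z - B%:Z) * (r2%:Z * p1%:Z - r1%:Z * p2%:Z) = 0 by nra.
  by move/eqP; rewrite mulf_eq0 => /orP [] /eqP; lia.
(* Degree 3 combines an even summand of degree 2 with the summand 0 of degree 1. The choice depends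
   on the parity of [p] and on its position relative to 2B and 2A. *)
have G3 p : (p <= 3 * B)%N -> p != 1%N -> G 3%N p.
  move=> pB p1.
  have [od|ev] := boolP (odd p); last have [h|h] := leqP p (2 * B).
  - have [h|h] := leqP p (2 * B).+1.
      have -> : (p = p.-1 + 0 + 1)%N by lia.
      by apply: (GJ 2%N _ 1%N) => //; [lia | apply: G2e => //; lia | lia].
    have [h2|h2] := leqP p (2 * A).
      have -> : (p = 2 * B + 0 + (p - 2 * B))%N by lia.
      apply: (GT 2%N _ 1%N) => //; first by apply: G2e; rewrite // oddM.
      by rewrite subnn; apply: kappa_first; lia.
    (* As [p] is odd, this [q] is even, and [j] is one less than the sum of the two exponents left
       at the first point. *)
    pose q := (2 * (A + B) - p.+1)%N.
    have -> : (p = q + 0 + ((2 * A - q) + (2 * B - q)).-1)%N by rewrite /q; lia.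
    apply: (GT 2%N _ 1%N) => //; [rewrite /q; lia | | ].
      by apply: G2e; rewrite /q; lia.
    by rewrite !mul1n !subn0; apply: kappa_subextreme; rewrite /q; lia.
  - rewrite -[p]addn0; apply: (GM 2%N _ 1%N) => //; exact: G2e.
  - have [h2|h2] := leqP p (2 * A).
      have -> : (p = 2 * B + 0 + (p - 2 * B))%N by lia.
      apply: (GT 2%N _ 1%N) => //; first by apply: G2e; rewrite // oddM.
      by rewrite subnn; apply: kappa_first; lia.
    (* Here [j] is exactly the sum of the two exponents left at the first point. *)
    pose q := (2 * (A + B) - p)%N.
    have -> : (p = q + 0 + ((2 * A - q) + (2 * B - q)))%N by rewrite /q; lia.
    apply: (GT 2%N _ 1%N) => //; [rewrite /q; lia | | ].
      by apply: G2e; rewrite /q; lia.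
    by rewrite !mul1n !subn0; apply: kappa_extreme; rewrite /q; lia.
(* Beyond 3B, two summands of degree 2 are combined, one of them the top one 2B; odd [p] need
   [j = 1]. *)
have G4 p : (p <= 4 * B)%N -> p != 1%N -> G 4%N p.
  move=> pB p1; have [h|h] := leqP p (3 * B).
    by rewrite -[p]addn0; apply: (GM 3%N _ 1%N) => //; apply: G3.
  have [od|ev] := boolP (odd p).
    have -> : (p = 2 * B + (p.-1 - 2 * B) + 1)%N by lia.
    by apply: (GJ 2%N _ 2%N); try apply: G2e; lia.
  have -> : (p = 2 * B + (p - 2 * B))%N by lia.
  by apply: (GM 2%N _ 2%N); try apply: G2e; lia.
move=> r; elim/ltn_ind: r => -[|[|[|[|[|r]]]]] // IH p _ pB p1.
- exact: G3.
- exact: G4.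
have IHr := IH r.+3; rewrite -(addn2 r.+3).
have [h|h] := leqP p (r.+3 * B).
  by rewrite -[p]addn0; apply: (GM _ _ 2%N) => //; [apply: IHr; lia | apply: G2e].
(* Since p > (r + 3) B, removing 2B leaves more than (r + 1) B, so the excluded index 1 is
   avoided. *)
have -> : (p = (p - 2 * B) + 2 * B)%N by nia.
have ? : (p - 2 * B <= r.+3 * B)%N by nia.
apply: GM => //; last by apply: G2e => //; rewrite oddM.
apply: IHr => //; nia.
Qed.

(** * The Cayley operator *)

Lemma comp_mpolyM (S : comNzRingType) M N (t : M.-tuple {mpoly S[N]}) :
  {morph comp_mpoly t : P Q / P * Q}.
Proof. exact: rmorphM. Qed.

Lemma mulA_mpolyC (S : comNzRingType) M (u v : S) (P : {mpoly S[M]}) :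
  u%:MP * (v%:MP * P) = (u * v)%:MP * P.
Proof. by rewrite mulrA mpolyCM. Qed.

Section Cayley.
Variables (S : comNzRingType) (ax ay bx by_ : S).
Notation P4 := {mpoly S[4]}.

Lemma mderivXn M (p : {mpoly S[M]}) i k :
  (p ^+ k)^`M(i) = k%:R * (p^`M(i) * p ^+ k.-1).
Proof.
elim: k => [|k IHk]; first by rewrite expr0 -mpolyC1 mderivC mul0r.
rewrite exprS mderivM IHk; case: k {IHk} => [|k] /=.
  by rewrite !mul0r mulr0 addr0 expr0 !mulr1 mul1r.
by rewrite (exprS _ k) [in RHS]mulrS; ring.
Qed.

Definition cayley (P : P4) : P4 :=
  P^`M(inord 0)^`M(inord 3) - P^`M(inord 1)^`M(inord 2).

Definition pencil (u v : S) (z w : P4) : P4 := u%:MP * z + v%:MP * w.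

Let x1 : P4 := 'X_(inord 0).
Let y1 : P4 := 'X_(inord 1).
Let x2 : P4 := 'X_(inord 2).
Let y2 : P4 := 'X_(inord 3).

Definition pencil_monomial (a b c d : nat) : P4 :=
  (pencil ax ay x1 y1 ^+ a * pencil bx by_ x1 y1 ^+ b) *
  (pencil ax ay x2 y2 ^+ c * pencil bx by_ x2 y2 ^+ d).

Let subm_self (m : 'X_{1..4}) : (m - m)%MM = 0%MM.
Proof. by apply/mnmP => i; rewrite mnmBE subnn mnm0E. Qed.

Let mderiv_pencil u v (i j k : nat) : (i < 4)%N -> (j < 4)%N -> (k < 4)%N ->
  (pencil u v 'X_(inord i) 'X_(inord j))^`M(inord k) =
  ((k == i)%:R * u + (k == j)%:R * v)%:MP.
Proof.
move=> i4 j4 k4; rewrite /pencil mderivD !mderiv_mulC !mderivX !mnm1E.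
have E (l m : nat) : (l < 4)%N -> (m < 4)%N ->
    (inord l == inord m :> 'I_4) = (m == l).
  by move=> l4 m4; rewrite -val_eqE /= !inordK // eq_sym.
rewrite !E // mpolyCD !mpolyCM; congr (_ + _); rewrite mulrC; congr (_ * _).
  by case: eqP => [->|_]; rewrite ?scale0r ?mpolyC0 ?scale1r ?subm_self ?mpolyX0.
by case: eqP => [->|_]; rewrite ?scale0r ?mpolyC0 ?scale1r ?subm_self ?mpolyX0.
Qed.

(** Terms in which both points are differentiated through the same form carry a zero determinant;
    the mixed ones carry plus or minus the determinant of the two forms. *)
Lemma cayley_pencil_monomial a b c d :
  cayley (pencil_monomial a b c d) = (ax * by_ - ay * bx)%:MP *
   ((a * d)%:R * pencil_monomial a.-1 b c d.-1 -
    (b * c)%:R * pencil_monomial a b.-1 c.-1 d).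
Proof.
have mderiv_nat i c' : (c'%:R : P4)^`M(i) = 0.
  by rewrite -mpolyC_nat mderivC.
rewrite /cayley /pencil_monomial /x1 /y1 /x2 /y2.
rewrite !(mderivM, mderivXn, mderiv_pencil, mderivC, mderiv_nat, mderivD) //=.
rewrite !(mul0r, mul1r, addr0, add0r, mpolyC0, mulr0).
rewrite mpolyCB !mpolyCM.
rewrite !natrM; move: (_ ^+ a.-1) (_ ^+ b.-1) (_ ^+ c.-1) (_ ^+ d.-1).
move: (_ ^+ a) (_ ^+ b) (_ ^+ c) (_ ^+ d) => La Mb Lc Md La' Mb' Lc' Md'.
by move: a%:R b%:R c%:R d%:R => a' b' c' d'; ring.
Qed.

Lemma cayleyZ c P : cayley (c%:MP * P) = c%:MP * cayley P.
Proof. by rewrite /cayley !mderiv_mulC mulrBr. Qed.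

Lemma cayleyB P Q : cayley (P - Q) = cayley P - cayley Q.
Proof. by rewrite /cayley !mderivB; ring. Qed.

Lemma iter_cayleyZ j c P : iter j cayley (c%:MP * P) = c%:MP * iter j cayley P.
Proof. by elim: j => //= j ->; rewrite cayleyZ. Qed.

Lemma iter_cayleyB j P Q : iter j cayley (P - Q) = iter j cayley P - iter j cayley Q.
Proof. by elim: j => //= j ->; rewrite cayleyB. Qed.

Lemma transvectant_pencils j a b c d (z w : P4) :
  iter j cayley (pencil_monomial a b c d) \mPo [tuple z; w; z; w] =
  ((ax * by_ - ay * bx) ^+ j * (kappa j a b c d)%:~R)%:MP *
   (pencil ax ay z w ^+ (a + c - j) * pencil bx by_ z w ^+ (b + d - j)).
Proof.
elim: j a b c d => [|j IHj] a b c d.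
  rewrite /= !subn0 expr0 mulr1 mpolyC1 mul1r /pencil_monomial.
  have X (k : nat) : (k < 4)%N -> 'X_(inord k) \mPo [tuple z; w; z; w] = [tuple z; w; z; w]`_k :> P4.
    by move=> k4; rewrite comp_mpolyXU inordK.
  rewrite !rmorphM /= !rmorphXn /= /pencil !rmorphD /= !rmorphM /= !comp_mpolyC.
  by rewrite !X //= !exprD; ring.
rewrite iterSr cayley_pencil_monomial iter_cayleyZ iter_cayleyB.
rewrite -!mpolyC_nat !iter_cayleyZ.
rewrite comp_mpolyM comp_mpolyB !comp_mpolyM !comp_mpolyC !IHj /=.
rewrite [(_ - _)%:~R]rmorphB !(rmorphM (intmul 1)) /= !pmulrn.
set D := ax * by_ - ay * bx.
(* If [a] or [d] is zero, the truncated exponents disagree, but the factor [a * d] vanishes. *)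
have E1 : (a * d)%:R * (pencil ax ay z w ^+ (a.-1 + c - j) *
    pencil bx by_ z w ^+ (b + d.-1 - j)) = (a * d)%:R * (pencil ax ay z w ^+ (a + c - j.+1) *
    pencil bx by_ z w ^+ (b + d - j.+1)).
  case: a d => [|a] [|d]; rewrite ?muln0 ?mul0n ?mul0r //.
  by rewrite !addSn !addnS !subSS.
have E2 : (b * c)%:R * (pencil ax ay z w ^+ (a + c.-1 - j) *
    pencil bx by_ z w ^+ (b.-1 + d - j)) = (b * c)%:R * (pencil ax ay z w ^+ (a + c - j.+1) *
    pencil bx by_ z w ^+ (b + d - j.+1)).
  case: b c {E1} => [|b] [|c]; rewrite ?muln0 ?mul0n ?mul0r //.
  by rewrite !addSn !addnS !subSS.
transitivity (D%:MP * (D ^+ j)%:MP * (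
  (kappa j a.-1 b c d.-1)%:~R%:MP * ((a * d)%:R * (pencil ax ay z w ^+ (a.-1 + c - j) *
    pencil bx by_ z w ^+ (b + d.-1 - j))) -
  (kappa j a b.-1 c.-1 d)%:~R%:MP * ((b * c)%:R * (pencil ax ay z w ^+ (a + c.-1 - j) *
    pencil bx by_ z w ^+ (b.-1 + d - j))))).
  by rewrite !mpolyCM !mpolyC_nat; ring.
rewrite E1 E2 exprS !(mpolyCM, mpolyCB) -!pmulrn !mpolyC_nat.
by ring.
Qed.

End Cayley.

(** * Restrictions of forms *)

Section Image.
Variables (K : numFieldType) (n d A B : nat).
Hypothesis dAB : d = (A + B)%N.

Notation S := {mpoly K[n.+1 + n.+1]}.

Definition lin1 (x : 'I_n.+1 -> K) : S := \sum_i x i *: 'X_(lshift n.+1 i).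
Definition lin2 (x : 'I_n.+1 -> K) : S := \sum_i x i *: 'X_(rshift n.+1 i).
Definition minor (x y : 'I_n.+1 -> K) : S := lin1 x * lin2 y - lin1 y * lin2 x.

(** The form L_1^A L_2^B with indeterminate coefficients: the left block of variables of [S] for
    L_1, the right block for L_2. *)
Definition generic_form : {mpoly S[n.+1]} :=
  (\sum_i ('X_(lshift n.+1 i) : S)%:MP * 'X_i) ^+ A *
  (\sum_i ('X_(rshift n.+1 i) : S)%:MP * 'X_i) ^+ B.

Definition form_coord : (formsN n d).+1.-tuple S :=
  [tuple generic_form@_(nth 0%MM (form_monomials n d) i) | i < (formsN n d).+1].

Definition restricted (r : nat) (F : S) : Prop :=
  exists2 T : {mpoly K[(formsN n d).+1]}, T \is r.-homog & F = T \mPo form_coord.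

Lemma restricted0 r : restricted r 0.
Proof. by exists 0; rewrite ?dhomog0 // comp_mpoly0. Qed.

Lemma restrictedD r F G : restricted r F -> restricted r G -> restricted r (F + G).
Proof.
move=> [T hT ->] [U hU ->]; exists (T + U); first by rewrite dhomogD.
by rewrite comp_mpolyD.
Qed.

Lemma restrictedZ r c F : restricted r F -> restricted r (c *: F).
Proof.
by move=> [T hT ->]; exists (c *: T); rewrite ?dhomogZ // comp_mpolyZ.
Qed.

Lemma restrictedM r s F G :
  restricted r F -> restricted s G -> restricted (r + s) (F * G).
Proof.
move=> [T hT ->] [U hU ->]; exists (T * U); first by rewrite dhomogM.
by rewrite [RHS]rmorphM.
Qed.

Lemma restrictedC c : restricted 0 c%:MP.
Proof.
exists c%:MP; last by rewrite comp_mpolyC.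
apply/dhomogP => m; rewrite mcoeff_msupp mcoeffC.
have [-> _|_] := eqVneq m 0%MM; first exact: mdeg0.
by rewrite mulr0 eqxx.
Qed.

Lemma restricted_sum r (I : Type) (s : seq I) (P : pred I) (F : I -> S) :
  (forall i, P i -> restricted r (F i)) -> restricted r (\sum_(i <- s | P i) F i).
Proof.
by move=> h; apply: big_ind => //; [exact: restricted0 | exact: restrictedD].
Qed.

Lemma generic_form_homog : generic_form \is d.-homog.
Proof.
rewrite dAB -(mul1n A) -(mul1n B); apply: dhomogM; apply: dhomogMn.
  by apply: rpred_sum => i _; rewrite mul_mpolyC dhomogZ // dhomogX; apply/eqP/mdeg1.
by apply: rpred_sum => i _; rewrite mul_mpolyC dhomogZ // dhomogX; apply/eqP/mdeg1.
Qed.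

Lemma restricted_coord m : restricted 1 generic_form@_m.
Proof.
have [md|md] := eqVneq (mdeg m) d; last first.
  by rewrite (dhomog_nemf_coeff generic_form_homog md); apply: restricted0.
have : m \in form_monomials n d by rewrite /form_monomials -basis_cover md.
move=> mi; have im : (index m (form_monomials n d) < (formsN n d).+1)%N.
  by rewrite -size_form_monomials index_mem.
exists 'X_(Ordinal im); first by rewrite dhomogX; apply/eqP/mdeg1.
by rewrite comp_mpolyXU -tnth_nth tnth_mktuple /= nth_index.
Qed.

(** Treating a family as a polynomial in auxiliary variables lets Omega and substitutions act on all
    its members at once. *)
Definition restricted_family M (r : nat) (P : {mpoly S[M]}) : Prop :=
  forall m, restricted r P@_m.

Definition constant_family M (q : {mpoly K[M]}) : {mpoly S[M]} :=
  map_mpoly (@mpolyC _ K) q.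

Section Families.
Variable M : nat.
Implicit Types P Q : {mpoly S[M]}.

Lemma restricted_familyB r P Q : restricted_family r P -> restricted_family r Q ->
  restricted_family r (P - Q).
Proof.
move=> hP hQ m; rewrite mcoeffB -scaleN1r.
by apply: restrictedD => //; apply: restrictedZ.
Qed.

Lemma restricted_familyM r s P Q : restricted_family r P -> restricted_family s Q ->
  restricted_family (r + s) (P * Q).
Proof.
by move=> hP hQ m; rewrite mcoeffM; apply: restricted_sum => i _; apply: restrictedM.
Qed.

Lemma restricted_family_sum r (I : Type) (s : seq I) (F : I -> {mpoly S[M]}) :
  (forall i, restricted_family r (F i)) -> restricted_family r (\sum_(i <- s) F i).
Proof. by move=> h m; rewrite raddf_sum; apply: restricted_sum => i _; apply: h. Qed.

Lemma restricted_family_constant q : restricted_family 0 (constant_family q : {mpoly S[M]}).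
Proof. by move=> m; rewrite mcoeff_map_mpoly; apply: restrictedC. Qed.

Lemma constant_familyD (q q' : {mpoly K[M]}) :
  constant_family (q + q') = constant_family q + constant_family q'.
Proof. exact: rmorphD. Qed.

Lemma constant_familyZ c (q : {mpoly K[M]}) :
  constant_family (c *: q) = c%:MP%:MP * constant_family q.
Proof. by rewrite /constant_family map_mpolyZ /= -mul_mpolyC. Qed.

Lemma restricted_family_mderiv r i P :
  restricted_family r P -> restricted_family r P^`M(i).
Proof.
move=> hP m; rewrite mcoeff_deriv -(@scaler_nat K).
by apply: restrictedZ.
Qed.

Lemma restricted_familyC r F : restricted r F -> restricted_family r (F%:MP : {mpoly S[M]}).
Proof.
move=> hF m; rewrite mcoeffC; case: eqP => _; first by rewrite mulr1.
by rewrite mulr0; apply: restricted0.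
Qed.

End Families.

Lemma restricted_family_comp r (P : {mpoly S[4]}) (z w : {mpoly K[4]}) :
  restricted_family r P ->
  restricted_family r (P \mPo [tuple constant_family z; constant_family w;
                               constant_family z; constant_family w]).
Proof.
move=> hP; rewrite comp_mpolyEX; apply: restricted_family_sum => m.
rewrite comp_mpolyX -mul_mpolyC -[r]addn0.
apply: restricted_familyM; first exact: restricted_familyC.
suff -> : \prod_(i < 4) tnth [tuple constant_family z; constant_family w;
      constant_family z; constant_family w] i ^+ m i =
    constant_family (\prod_(i < 4) tnth [tuple z; w; z; w] i ^+ m i).
  exact: restricted_family_constant.
rewrite /constant_family rmorph_prod; apply: eq_bigr => i _; rewrite rmorphXn.
by case: i => -[|[|[|[|]]]] // ?; rewrite !(tnth_nth 0).
Qed.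

(** The spanning family of the summand [p], evaluated at the point z x + w y. Four variables allow
    two independent points before Omega is applied and a common one afterwards. *)
Definition reachable (r p : nat) : Prop :=
  forall x y (z w : {mpoly K[4]}),
  restricted_family r ((minor x y ^+ p)%:MP *
    (pencil (lin1 x) (lin1 y) (constant_family z) (constant_family w) ^+ (r * A - p) *
     pencil (lin2 x) (lin2 y) (constant_family z) (constant_family w) ^+ (r * B - p))).

Lemma reachable10 : reachable 1 0.
Proof.
move=> x y z w; rewrite expr0 mpolyC1 mul1r !mul1n !subn0.
(* The point z x + w y, to be substituted into the generic form, whose coefficients are
   coordinates. *)
pose v i := constant_family (x i *: z + y i *: w).
have E (h : 'I_n.+1 -> 'I_(n.+1 + n.+1)) :
  pencil (\sum_i x i *: 'X_(h i)) (\sum_i y i *: 'X_(h i)) (constant_family z)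
    (constant_family w) =
  mmap (@mpolyC _ S) v (\sum_i ('X_(h i) : S)%:MP * 'X_i).
  rewrite /pencil !raddf_sum /= !mulr_suml -big_split /=; apply: eq_bigr => i _.
  rewrite rmorphM /= mmapC mmapX mmap1U /v constant_familyD !constant_familyZ.
  rewrite -(mul_mpolyC (x i) 'X_(h i)) -(mul_mpolyC (y i) 'X_(h i)) !mpolyCM.
  transitivity (('X_(h i))%:MP * ((x i)%:MP%:MP * constant_family z +
      (y i)%:MP%:MP * constant_family w)); last by [].
  move: (constant_family z) (constant_family w) ('X_(h i))%:MP => z' w' t.
  by move: (x i)%:MP%:MP (y i)%:MP%:MP => a b; ring.
rewrite (E (lshift n.+1)) (E (@rshift n.+1 n.+1)).
suff : restricted_family 1 (mmap (@mpolyC _ S) v generic_form).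
  by rewrite /generic_form rmorphM !rmorphXn.
apply: restricted_family_sum => m.
apply: (@restricted_familyM _ 1 0); first by apply: restricted_familyC; apply: restricted_coord.
suff -> : mmap1 v m = constant_family (\prod_i (x i *: z + y i *: w) ^+ m i).
  exact: restricted_family_constant.
by rewrite /constant_family rmorph_prod; apply: eq_bigr => i _; rewrite rmorphXn.
Qed.

Lemma reachable_transvectant r1 p1 r2 p2 j :
  (p1 <= r1 * B)%N -> (p2 <= r2 * B)%N -> (B <= A)%N ->
  reachable r1 p1 -> reachable r2 p2 ->
  kappa j (r1 * A - p1) (r1 * B - p1) (r2 * A - p2) (r2 * B - p2) != 0 ->
  reachable (r1 + r2) (p1 + p2 + j).
Proof.
move=> pB1 pB2 BA R1 R2 k0 x y z w.
have X i : constant_family 'X_i = 'X_i :> {mpoly S[4]} by rewrite /constant_family map_mpolyX.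
(* The two families are taken at independent points, with coordinates in the variables 0, 1 and 2,
   3. *)
have := R2 x y 'X_(inord 2) 'X_(inord 3).
have := R1 x y 'X_(inord 0) 'X_(inord 1); rewrite !X => /restricted_familyM/[apply].
set a := (r1 * A - p1)%N in k0 *; set b := (r1 * B - p1)%N in k0 *.
set a' := (r2 * A - p2)%N in k0 *; set b' := (r2 * B - p2)%N in k0 *.
have -> (u v : S) (P Q : {mpoly S[4]}) : u%:MP * P * (v%:MP * Q) = (u * v)%:MP * (P * Q).
  by rewrite mpolyCM; ring.
rewrite -exprD -/(pencil_monomial _ _ _ _ _ _ _ _).
move=> H.
have {}H : restricted_family (r1 + r2) (iter j (@cayley _)
   ((minor x y ^+ (p1 + p2))%:MP *
     pencil_monomial (lin1 x) (lin1 y) (lin2 x) (lin2 y) a b a' b')).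
  elim: j {k0} => [//|j IHj] /=.
  by apply: restricted_familyB; do 2 apply: restricted_family_mderiv.
(* Both points are now set equal to the one given by [z], [w]. *)
move: H => /(restricted_family_comp z w); rewrite iter_cayleyZ.
rewrite comp_mpolyM comp_mpolyC transvectant_pencils -/(minor x y) mulA_mpolyC.
rewrite (mulrA (minor x y ^+ (p1 + p2))) -(exprD (minor x y)).
have lA1 : (p1 <= r1 * A)%N by apply: leq_trans pB1 _; rewrite leq_mul2l BA orbT.
have lA2 : (p2 <= r2 * A)%N by apply: leq_trans pB2 _; rewrite leq_mul2l BA orbT.
have -> : (a + a' - j = (r1 + r2) * A - (p1 + p2 + j))%N by rewrite /a /a'; lia.
have -> : (b + b' - j = (r1 + r2) * B - (p1 + p2 + j))%N by rewrite /b /b'; lia.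
set c := kappa _ _ _ _ _ in k0 *.
have c0 : c%:~R != 0 :> K by rewrite intr_eq0.
move=> H; have := restricted_familyM (restricted_family_constant ((c%:~R)^-1)%:MP) H.
rewrite add0n {1}/constant_family map_mpolyC mulA_mpolyC.
have -> : ((c%:~R)^-1)%:MP * (minor x y ^+ (p1 + p2 + j) * c%:~R) =
    minor x y ^+ (p1 + p2 + j) :> S.
  rewrite -[c%:~R in X in _ * (_ * X)](rmorph_int (@mpolyC (n.+1 + n.+1) K)).
  by rewrite mulrCA -mpolyCM mulVf // mulr1.
by [].
Qed.

Lemma reachable_minor r p x y : reachable r p ->
  restricted r (minor x y ^+ p * (lin1 x ^+ (r * A - p) * lin2 x ^+ (r * B - p))).
Proof.
(* With [z = 1] and [w = 0] the family is constant, and its constant coefficient is the claim. *)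
move=> R; have := R x y 1 0 0%MM; rewrite /constant_family rmorph1 rmorph0.
by rewrite /pencil !mulr1 !mulr0 !addr0 -!rmorphXn -!mpolyCM mpolyCK.
Qed.

Lemma restricted_minor r p x y : (0 < B)%N -> (B < A)%N ->
  (3 <= r)%N -> (p <= r * B)%N -> p != 1%N ->
  restricted r (minor x y ^+ p * (lin1 x ^+ (r * A - p) * lin2 x ^+ (r * B - p))).
Proof.
move=> B0 BA r3 pB p1; apply: reachable_minor.
apply: (reachable_transvectants B0 BA reachable10 _ r3 pB p1) => *.
by apply: reachable_transvectant => //; apply: ltnW.
Qed.

End Image.

(** * Spanning bihomogeneous forms *)

Section Span.
Variables (K : numFieldType) (V : comAlgType K) (J : V -> Prop).
Hypothesis J0 : J 0.
Hypothesis JD : forall f g, J f -> J g -> J (f + g).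
Hypothesis JZ : forall c f, J f -> J (c *: f).

Lemma subspace_sum (I : Type) (s : seq I) (P : pred I) (F : I -> V) :
  (forall i, P i -> J (F i)) -> J (\sum_(i <- s | P i) F i).
Proof. by move=> h; apply: big_ind. Qed.

Lemma subspaceB f g : J f -> J g -> J (f - g).
Proof. by move=> hf hg; rewrite -scaleN1r; apply: JD => //; apply: JZ. Qed.

Lemma subspaceZ_inv c f : c != 0 -> J (c *: f) -> J f.
Proof. by move=> c0 /(JZ c^-1); rewrite scalerA mulVf // scale1r. Qed.

Lemma horner_pencils (w ax ay bx by_ : V) a b (t : K) :
  (w%:P * ((ax%:P + ay%:P * 'X) ^+ a * (bx%:P + by_%:P * 'X) ^+ b)).[t%:A] =
  w * ((ax + t *: ay) ^+ a * (bx + t *: by_) ^+ b).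
Proof. by rewrite !hornerM !horner_exp !hornerE !mulr_algr. Qed.

Lemma subspace_coef (E : {poly V}) k : (forall t : K, J E.[t%:A]) -> J E`_k.
Proof.
move=> hE; have -> : E`_k = \sum_(i < size E) (lagr K i)`_k *: E.[i%:R%:A].
  under eq_bigr => i _.
    rewrite horner_coef scaler_sumr; under eq_bigr => l _.
      rewrite exprZn expr1n mulr_algr scalerA; over.
    over.
  rewrite exchange_big /=; under eq_bigr => l _.
    have Xl : (size ('X^l : {poly K}) <= size E)%N by rewrite size_polyXn.
    rewrite -scaler_suml.
    under eq_bigr => i _ do rewrite -[_ ^+ l](hornerXn).
    rewrite -(coef_from_values k Xl) coefXn; over.
  have [kE|Ek] := ltnP k (size E).
    rewrite (bigD1 (Ordinal kE)) //= eqxx scale1r big1 ?addr0 // => l lk.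
    case: eqP => [e|_]; last by rewrite scale0r.
    by case/eqP: lk; apply: val_inj.
  rewrite nth_default // big1 // => l _; case: eqP => [e|_]; last by rewrite scale0r.
  by move: Ek; rewrite e leqNgt ltn_ord.
by apply: subspace_sum => i _; apply: JZ.
Qed.

(** The coefficient of t in L(x + t y)^(k+1) is (k + 1) L(x)^k L(y), so one power at a time can be
    traded for an arbitrary factor. *)
Lemma subspace_polarization m (L : ('I_m -> K) -> V) k g :
  (forall x y t, L (fun i => x i + t * y i) = L x + t *: L y) ->
  (forall x, J (L x ^+ k * g)) ->
  forall s, size s = k -> J ((\prod_(x <- s) L x) * g).
Proof.
move=> linL; elim: k g => [|k IHk] g hg s.
  by move/size0nil->; rewrite big_nil; apply: (hg (fun=> 0)).
case: s => [//|y s] [sk]; rewrite big_cons (mulrC (L y)) -mulrA; apply: IHk => // x.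
pose E := ((L x)%:P + (L y)%:P * 'X) ^+ k.+1 * g%:P.
have : J E`_1.
  apply: subspace_coef => t; rewrite /E hornerM horner_exp !hornerE.
  by rewrite mulr_algr -linL.
rewrite /E coefMC coef_pencil bin1 subn1 expr1 -(@scaler_nat K) -scalerAl -mulrA.
by apply: subspaceZ_inv; rewrite pnatr_eq0.
Qed.

Section PencilSpan.
Variables (ax ay bx by_ : V) (P Q : nat).
Hypothesis QP : (Q <= P)%N.
Let D := ax * by_ - ay * bx.
Hypothesis hJ : forall p k, (p <= Q)%N -> J (D ^+ p *
  ((ax%:P + ay%:P * 'X) ^+ (P - p) * (bx%:P + by_%:P * 'X) ^+ (Q - p))`_k).

Let mon p i j := D ^+ p * (ax ^+ (P - p - i) * ay ^+ i * (bx ^+ (Q - p - j) * by_ ^+ j)).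

Let mon_step p i j : (i < P - p)%N -> (j < Q - p)%N ->
  mon p i j.+1 - mon p i.+1 j = mon p.+1 i j.
Proof.
move=> iP jQ; rewrite /mon -!subnDA.
have -> : (P - (p + i) = (P - (p.+1 + i)).+1)%N by lia.
have -> : (Q - (p + j) = (Q - (p.+1 + j)).+1)%N by lia.
have -> : (P - (p + i.+1) = P - (p.+1 + i))%N by lia.
have -> : (Q - (p + j.+1) = Q - (p.+1 + j))%N by lia.
by rewrite !exprS /D; ring.
Qed.

(* By [mon_step], modulo the multiples of [D], all the [mon p i j] with the same
   [i + j] agree, so that each is a multiple of a coefficient of the pencil. *)
Lemma pencil_span p i j : (p <= Q)%N -> (i <= P - p)%N -> (j <= Q - p)%N -> J (mon p i j).
Proof.
have [q] := ubnP (Q - p); elim: q => [//|q IHq] in p i j *.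
move=> pq pQ iP jQ.
(* Telescoping with [mon_step]; the multiples of the next power of [D] are covered by the induction
   on [Q - p]. *)
have diff l i' j' : (i' + l <= P - p)%N -> (j' + l <= Q - p)%N ->
    J (mon p i' (j' + l) - mon p (i' + l) j').
  elim: l i' j' => [|l IHl] i' j' hi hj; first by rewrite !addn0 subrr.
  have -> : mon p i' (j' + l.+1) - mon p (i' + l.+1) j' =
      mon p.+1 i' (j' + l) + (mon p i'.+1 (j' + l) - mon p (i'.+1 + l) j').
    rewrite -mon_step; [| lia | lia].
    by rewrite !addnS addSn; ring.
  by apply: JD; [apply: IHq; lia | apply: IHl; lia].
have diff2 i1 j1 i2 j2 : (i1 + j1 = i2 + j2)%N -> (i1 <= P - p)%N -> (i2 <= P - p)%N ->
    (j1 <= Q - p)%N -> (j2 <= Q - p)%N -> J (mon p i1 j1 - mon p i2 j2).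
  move=> e h1 h2 h3 h4; have [h|/ltnW h] := leqP i1 i2.
    have := diff (i2 - i1)%N i1 j2.
    rewrite (_ : j2 + (i2 - i1) = j1)%N; last by lia.
    by rewrite subnKC //; apply; lia.
  rewrite -opprB -scaleN1r; apply: JZ.
  have := diff (i1 - i2)%N i2 j1.
  rewrite (_ : j1 + (i1 - i2) = j2)%N; last by lia.
  by rewrite subnKC //; apply; lia.
(* The [w l] are the weights of the [mon p l (k - l)] in the k-th coefficient of the pencil; they
   vanish when an index is out of range. *)
pose k := (i + j)%N; pose w (l : nat) := ('C(P - p, l) * 'C(Q - p, k - l))%N.
have H : J (\sum_(l < k.+1) (w l)%:R *: mon p l (k - l)).
  have := hJ k pQ; rewrite coefM mulr_sumr; congr J; apply: eq_bigr => l _.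
  rewrite !coef_pencil scaler_nat /mon /w -mulrnAl -mulrnAr mulnC mulrnA.
  by rewrite !(mulrnAl, mulrnAr).
have H2 : J (\sum_(l < k.+1) (w l)%:R *: (mon p l (k - l) - mon p i j)).
  apply: subspace_sum => l _; have lk : (l <= k)%N by rewrite -ltnS.
  have [h1|h1] := ltnP (P - p) l; first by rewrite /w bin_small // mul0n scale0r.
  have [h2|h2] := ltnP (Q - p) (k - l); first by rewrite /w [X in (_ * X)%N]bin_small // muln0 scale0r.
  by apply: JZ; apply: diff2 => //; rewrite subnKC.
have := subspaceB H H2; rewrite -sumrB.
under eq_bigr => l _ do rewrite scalerBr opprB addrC subrK.
rewrite -scaler_suml -natr_sum => /subspaceZ_inv; apply.
(* By Vandermonde the total weight is a single binomial coefficient, nonzero in this range. *)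
rewrite pnatr_eq0 -lt0n /w binomial.Vandermonde bin_gt0; lia.
Qed.

End PencilSpan.

End Span.

(** * The cuspidal direction along the diagonal *)

Section Diagonal.
Variables (K : numFieldType) (n d A B : nat).
Hypothesis dAB : d = (A + B)%N.

Notation S := {mpoly K[n.+1 + n.+1]}.
Implicit Types (a b c m x y : 'I_n.+1 -> K) (f g F : S).

Definition point (a b : 'I_n.+1 -> K) (i : 'I_(n.+1 + n.+1)) : K :=
  match split i with inl j => a j | inr j => b j end.

Lemma point_l a b i : point a b (lshift n.+1 i) = a i.
Proof. by rewrite /point (unsplitK (inl i)). Qed.

Lemma point_r a b i : point a b (rshift n.+1 i) = b i.
Proof. by rewrite /point (unsplitK (inr i)). Qed.

Definition dot (x c : 'I_n.+1 -> K) : K := \sum_i x i * c i.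

Definition on_line N (c c' : 'I_N -> K) : {mpoly K[N]} -> {poly K} :=
  mmap (@polyC K) (fun i => (c i)%:P + (c' i)%:P * 'X).

Lemma on_lineE N (c c' : 'I_N -> K) (f : {mpoly K[N]}) t :
  (on_line c c' f).[t] = f.@[fun i => c i + c' i * t].
Proof.
rewrite /on_line /mmap horner_sum mevalE; apply: eq_bigr => m _.
rewrite hornerM hornerC horner_prod; congr (_ * _); apply: eq_bigr => i _.
by rewrite horner_exp !hornerE.
Qed.

(* The direction in which [(a, b) |-> a^A b^B] has zero derivative at [(c, c)]. *)
Definition diag_line c m : S -> {poly K} :=
  on_line (point c c) (point (fun i => B%:R * m i) (fun i => - A%:R * m i)).

Lemma diag_line_lin1 c m x :
  diag_line c m (lin1 x) = (dot x c)%:P + (B%:R * dot x m)%:P * 'X.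
Proof.
rewrite /diag_line /on_line /lin1 raddf_sum /= /dot mulr_sumr !rmorph_sum /= mulr_suml.
rewrite -big_split; apply: eq_bigr => i _.
by rewrite mmapZ /= mmapX mmap1U !point_l !polyCM; ring.
Qed.

Lemma diag_line_lin2 c m x :
  diag_line c m (lin2 x) = (dot x c)%:P + (- A%:R * dot x m)%:P * 'X.
Proof.
rewrite /diag_line /on_line /lin2 raddf_sum /= /dot mulr_sumr !rmorph_sum /= mulr_suml.
rewrite -big_split; apply: eq_bigr => i _.
by rewrite mmapZ /= mmapX mmap1U !point_r !polyCM; ring.
Qed.

Lemma diag_lineM c m f g : diag_line c m (f * g) = diag_line c m f * diag_line c m g.
Proof. exact: rmorphM. Qed.

Lemma diag_lineX c m f k : diag_line c m (f ^+ k) = diag_line c m f ^+ k.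
Proof. exact: rmorphXn. Qed.

Lemma diag_lineB c m f g : diag_line c m (f - g) = diag_line c m f - diag_line c m g.
Proof. exact: rmorphB. Qed.

Definition diag_deriv c m f : K := (diag_line c m f)`_1.

Lemma diag_derivD c m f g : diag_deriv c m (f + g) = diag_deriv c m f + diag_deriv c m g.
Proof. by rewrite /diag_deriv /diag_line /on_line mmapD coefD. Qed.

Lemma diag_derivZ c m k f : diag_deriv c m (k *: f) = k * diag_deriv c m f.
Proof. by rewrite /diag_deriv /diag_line /on_line mmapZ coefCM. Qed.

Lemma expand2 (R : comNzRingType) (u v e : R) k :
  exists r, (u + e * v) ^+ k = u ^+ k + e * (k%:R * (u ^+ k.-1 * v)) + e ^+ 2 * r.
Proof.
elim: k => [|k [r IHk]]; first by exists 0; rewrite !expr0; ring.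
exists (u * r + k%:R * (u ^+ k.-1 * v) * v + e * r * v); rewrite exprS IHk.
have E : u * (k%:R * (u ^+ k.-1 * v)) = k%:R * (u ^+ k * v).
  by case: k {IHk} => [|k] /=; rewrite ?mul0r ?mulr0 // exprS; ring.
transitivity (u * u ^+ k + e * (u * (k%:R * (u ^+ k.-1 * v)) + u ^+ k * v) +
   e ^+ 2 * (u * r + k%:R * (u ^+ k.-1 * v) * v + e * r * v)); first by ring.
by rewrite E -exprS /= -natr1; ring.
Qed.

(** The terms linear in [e] are A B u^(A+B-1) v and its negative. *)
Lemma expand_diag (R : comNzRingType) (u v e : R) : exists r,
  (u + e * (B%:R * v)) ^+ A * (u + e * (- A%:R * v)) ^+ B = u ^+ (A + B) + e ^+ 2 * r.
Proof.
have [r1 ->] := expand2 u (B%:R * v) e A; have [r2 ->] := expand2 u (- A%:R * v) e B.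
have E : A%:R * (u ^+ A.-1 * (B%:R * v)) * u ^+ B + u ^+ A * (B%:R * (u ^+ B.-1 * (- A%:R * v))) = 0.
  case: A => [|A']; first by rewrite mulr0n; ring.
  case: B => [|B']; first by rewrite mulr0n; ring.
  by rewrite /= !exprS; ring.
exists (A%:R * (u ^+ A.-1 * (B%:R * v)) * (B%:R * (u ^+ B.-1 * (- A%:R * v))) +
  r1 * (u ^+ B + e * (B%:R * (u ^+ B.-1 * (- A%:R * v))) + e ^+ 2 * r2) +
  (u ^+ A + e * (A%:R * (u ^+ A.-1 * (B%:R * v)))) * r2).
transitivity (u ^+ A * u ^+ B + e * (A%:R * (u ^+ A.-1 * (B%:R * v)) * u ^+ B +
   u ^+ A * (B%:R * (u ^+ B.-1 * (- A%:R * v)))) + e ^+ 2 * (A%:R * (u ^+ A.-1 * (B%:R * v)) * (B%:R * (u ^+ B.-1 * (- A%:R * v))) +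
  r1 * (u ^+ B + e * (B%:R * (u ^+ B.-1 * (- A%:R * v))) + e ^+ 2 * r2) +
  (u ^+ A + e * (A%:R * (u ^+ A.-1 * (B%:R * v)))) * r2)).
  move: (u ^+ A) (u ^+ B) (u ^+ A.-1) (u ^+ B.-1) => a b a' b'; ring.
by rewrite E mulr0 addr0 exprD.
Qed.

Lemma diag_deriv_coord c m k : diag_deriv c m (generic_form K n A B)@_k = 0.
Proof.
rewrite /diag_deriv /diag_line /on_line.
set h := fun i => _.
(* Applied to the coefficients, restriction to the line turns the generic form into (u + t B v)^A (u
   - t A v)^B. *)
have -> : mmap (@polyC K) h (generic_form K n A B)@_k =
    (map_mpoly (mmap (@polyC K) h) (generic_form K n A B))@_k.
  by rewrite mcoeff_map_mpoly.
pose u0 : {mpoly K[n.+1]} := \sum_i c i *: 'X_i.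
pose v : {mpoly {poly K}[n.+1]} := \sum_i (m i)%:P *: 'X_i.
pose u := map_mpoly (@polyC K) u0.
have uE : u = \sum_i (c i)%:P *: 'X_i.
  by rewrite /u /u0 raddf_sum; apply: eq_bigr => i _; rewrite /= map_mpolyZ map_mpolyX.
have El : map_mpoly (mmap (@polyC K) h)
    (\sum_i ('X_(lshift n.+1 i) : S)%:MP * 'X_i : {mpoly S[n.+1]}) =
    u + ('X : {poly K})%:MP * (B%:R * v).
  rewrite raddf_sum uE /v /= !mulr_sumr -big_split; apply: eq_bigr => i _ /=.
  rewrite rmorphM /= map_mpolyC map_mpolyX /= mmapX mmap1U /h !point_l.
  rewrite -!mul_mpolyC -mpolyC_nat !mulrA -!mpolyCM -mulrDl -mpolyCD.
  by congr (_%:MP * _); rewrite polyCM rmorph_nat; ring.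
have Er : map_mpoly (mmap (@polyC K) h)
    (\sum_i ('X_(rshift n.+1 i) : S)%:MP * 'X_i : {mpoly S[n.+1]}) =
    u + ('X : {poly K})%:MP * (- A%:R * v).
  rewrite raddf_sum uE /v /= !mulr_sumr -big_split; apply: eq_bigr => i _ /=.
  rewrite rmorphM /= map_mpolyC map_mpolyX /= mmapX mmap1U /h !point_r.
  rewrite -!mul_mpolyC -mpolyC_nat -mpolyCN !mulrA -!mpolyCM -mulrDl -mpolyCD.
  by congr (_%:MP * _); rewrite polyCM polyCN rmorph_nat; ring.
rewrite /generic_form rmorphM /= !rmorphXn /= El Er.
have [q ->] := expand_diag u v ('X)%:MP.
rewrite mcoeffD -(rmorphXn (@mpolyC n.+1 {poly K})) /= mcoeffCM /u -rmorphXn.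
rewrite /= mcoeff_map_mpoly coefD coefC.
by rewrite coefXnM /= addr0.
Qed.

(** These polynomials form the ring K[t^2, t^3] of a cusp; it contains the coordinates, hence all
    polynomials in them. *)
Let vanish (p : {poly K}) := p`_1 = 0.

Let vanishM p q : vanish p -> vanish q -> vanish (p * q).
Proof.
by rewrite /vanish => p1 q1; rewrite coefM !big_ord_recr big_ord0 /= p1 q1; ring.
Qed.

Lemma diag_deriv_restricted r F c m : restricted d A B r F -> diag_deriv c m F = 0.
Proof.
move=> [T _ ->]; rewrite comp_mpolyEX; apply: (big_ind (fun f => diag_deriv c m f = 0)).
- by rewrite /diag_deriv /diag_line /on_line mmap0 coef0.
- by move=> f g hf hg; rewrite diag_derivD hf hg addr0.
move=> k _; rewrite diag_derivZ comp_mpolyX.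
suff -> : diag_deriv c m (\prod_(i < (formsN n d).+1) tnth (form_coord K n d A B) i ^+ k i) = 0.
  by rewrite mulr0.
apply: (big_ind (fun f => vanish (diag_line c m f))).
- by rewrite /vanish /diag_line /on_line rmorph1 coefC.
- by move=> f g hf hg; rewrite diag_lineM; apply: vanishM.
move=> i _; rewrite diag_lineX tnth_mktuple; elim: (k i) => [|l IHl].
  by rewrite expr0 /vanish coefC.
by rewrite exprS; apply: vanishM => //; apply: diag_deriv_coord.
Qed.

End Diagonal.

(** * Removing the summand p = 1 *)

Section Correction.
Variables (K : numFieldType) (n d A B r : nat).
Hypothesis dAB : d = (A + B)%N.
Hypotheses (B0 : (0 < B)%N) (BA : (B < A)%N) (r3 : (3 <= r)%N).

Notation S := {mpoly K[n.+1 + n.+1]}.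
Implicit Types (a b c m x y : 'I_n.+1 -> K) (f g F : S).

Let P := (r * A)%N.
Let Q := (r * B)%N.
Let N := (P.-1 + Q.-1).+1.

Let P0 : (0 < P)%N. Proof. by rewrite /P; nia. Qed.

Lemma lin1_point a b x : (lin1 x).@[point a b] = dot x a.
Proof.
rewrite /lin1 raddf_sum; apply: eq_bigr => i _ /=.
by rewrite mevalZ mevalXU point_l.
Qed.

Lemma lin2_point a b x : (lin2 x).@[point a b] = dot x b.
Proof.
rewrite /lin2 raddf_sum; apply: eq_bigr => i _ /=.
by rewrite mevalZ mevalXU point_r.
Qed.

Let dotD x a b t : dot x (fun i => a i + t * b i) = dot x a + t * dot x b.
Proof. by rewrite /dot mulr_sumr -big_split; apply: eq_bigr => i _ /=; ring. Qed.

Let linear_term x y := minor x y * (lin1 x ^+ P.-1 * lin2 x ^+ Q.-1) : S.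

(** Along the line the minor vanishes at t = 0 with linear coefficient -(A + B) times its value at
    (a, b), so the other factors only contribute their values on the diagonal. *)
Let diag_deriv_linear_term a b x y t :
  diag_deriv A B (fun i => a i + t * b i) b (linear_term x y) =
  - d%:R * (minor x y).@[point a b] * (dot x a + t * dot x b) ^+ (P.-1 + Q.-1).
Proof.
rewrite /diag_deriv /linear_term /minor !(diag_lineM, diag_lineB, diag_lineX).
rewrite !diag_line_lin1 !diag_line_lin2 mevalB !mevalM !lin1_point !lin2_point.
rewrite !dotD; set u := dot x a + _; set v := dot y a + _.
have -> : (u%:P + (B%:R * dot x b)%:P * 'X) * (v%:P + (- A%:R * dot y b)%:P * 'X) -
   (v%:P + (B%:R * dot y b)%:P * 'X) * (u%:P + (- A%:R * dot x b)%:P * 'X) =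
   'X * ((- d%:R * (dot x a * dot y b - dot y a * dot x b))%:P +
    (B%:R * - A%:R * (dot x b * dot y b - dot y b * dot x b))%:P * 'X).
  rewrite /u /v dAB natrD !(polyCM, polyCD, polyCN); ring.
rewrite -(mulrA 'X) coefXM /= -!horner_coef0 !hornerM !horner_exp !hornerE exprD.
exact: esym (mulrA _ _ _).
Qed.

(** When the derivative at a + t b in direction b is a polynomial in t of degree below [N], this is
    its coefficient of t^(Q-1). In (a.x + t b.x)^(P+Q-2) that coefficient is (a.x)^(P-1) (b.x)^(Q-1)
    up to a binomial, which recovers the summand p = 1. *)
Definition diag_average f a b : K :=
  \sum_(k < N) (lagr K k)`_Q.-1 * diag_deriv A B (fun i => a i + k%:R * b i) b f.

Let cst : K := d%:R * 'C(P.-1 + Q.-1, Q.-1)%:R.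

Let cst0 : cst != 0.
Proof.
rewrite mulf_neq0 // pnatr_eq0 -lt0n; first by rewrite dAB; lia.
by rewrite bin_gt0; lia.
Qed.

Let diag_average_linear_term a b x y :
  diag_average (linear_term x y) a b = - cst * (linear_term x y).@[point a b].
Proof.
rewrite /diag_average; under eq_bigr => k _ do
  rewrite diag_deriv_linear_term mulrCA.
rewrite -mulr_sumr.
pose p : {poly K} := ((dot x a)%:P + (dot x b)%:P * 'X) ^+ (P.-1 + Q.-1).
have sp : (size p <= N)%N.
  rewrite /p /N; apply: leq_trans (size_poly_exp_leq _ _) _; rewrite ltnS.
  have : (size ((dot x a)%:P + (dot x b)%:P * 'X)%R <= 2)%N.
    apply: leq_trans (size_polyD _ _) _; rewrite geq_max (leq_trans (size_polyC_leq1 _)) //.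
    by rewrite mulrC (leq_trans (size_polyMleq _ _)) // size_polyX; have := size_polyC_leq1 (dot x b); lia.
  by case: (size _) => [|[|[|]]] //= _; rewrite ?mul0n ?mul1n.
under eq_bigr => k _.
  have -> : (dot x a + k%:R * dot x b) ^+ (P.-1 + Q.-1) = p.[k%:R].
    by rewrite /p horner_exp !hornerE mulrC.
  over.
rewrite -(coef_from_values _ sp) /p coef_pencil addnK.
rewrite /linear_term !mevalM !rmorphXn /= lin1_point lin2_point /cst -mulr_natr.
ring.
Qed.

(* The operator [f |-> f + cst^-1 * diag_average f] removes the summand [p = 1]:
   [diag_average] vanishes on restrictions and is [- cst] on that summand. *)
Definition corrected f : Prop := exists2 F, restricted d A B r F &
  forall a b, f.@[point a b] + cst^-1 * diag_average f a b = F.@[point a b].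

Let corrected0 : corrected 0.
Proof.
exists 0; first exact: restricted0.
move=> a b; rewrite !meval0 add0r /diag_average big1 ?mulr0 // => k _.
by rewrite -(scale0r 0) diag_derivZ mul0r mulr0.
Qed.

Let correctedD f g : corrected f -> corrected g -> corrected (f + g).
Proof.
move=> [F hF eF] [G hG eG]; exists (F + G); first exact: restrictedD.
move=> a b; rewrite !mevalD -eF -eG /diag_average.
under eq_bigr => k _ do rewrite diag_derivD mulrDr.
by rewrite big_split /=; ring.
Qed.

Let correctedZ (c : K) f : corrected f -> corrected (c *: f).
Proof.
move=> [F hF eF]; exists (c *: F); first exact: restrictedZ.
move=> a b; rewrite !mevalZ -eF /diag_average.
under eq_bigr => k _ do rewrite diag_derivZ mulrCA.
by rewrite -mulr_sumr; ring.
Qed.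

Let corrected_restricted F : restricted d A B r F -> corrected F.
Proof.
move=> hF; exists F => // a b; rewrite /diag_average big1 ?mulr0 ?addr0 // => k _.
by rewrite (diag_deriv_restricted _ _ hF) mulr0.
Qed.

Let corrected_linear_term x y : corrected (linear_term x y).
Proof.
exists 0; first exact: restricted0.
by move=> a b; rewrite diag_average_linear_term meval0 mulNr mulrN mulrA mulVf // mul1r subrr.
Qed.

Let corrected_minor p x y : (p <= Q)%N ->
  corrected (minor x y ^+ p * (lin1 x ^+ (P - p) * lin2 x ^+ (Q - p))).
Proof.
move=> pQ; have [->|p1] := eqVneq p 1%N.
  by rewrite expr1 !subn1; apply: corrected_linear_term.
by apply: corrected_restricted; apply: restricted_minor.
Qed.

Let lin1D x y t : lin1 (fun i => x i + t * y i) = lin1 x + t *: lin1 y :> S.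
Proof.
rewrite /lin1 scaler_sumr -big_split; apply: eq_bigr => i _ /=.
by rewrite scalerDl scalerA.
Qed.

Let lin2D x y t : lin2 (fun i => x i + t * y i) = lin2 x + t *: lin2 y :> S.
Proof.
rewrite /lin2 scaler_sumr -big_split; apply: eq_bigr => i _ /=.
by rewrite scalerDl scalerA.
Qed.

Let corrected_powers x y : corrected (lin1 x ^+ P * lin2 y ^+ Q).
Proof.
have QP : (Q <= P)%N by rewrite leq_mul2l (ltnW BA) orbT.
(* The indices [p = 0], [i = 0], [j = Q] single out [lin1 x ^+ P * lin2 y ^+ Q]. *)
have := @pencil_span K S corrected corrected0 correctedD correctedZ
  (lin1 x) (lin1 y) (lin2 x) (lin2 y) P Q QP _ 0 0 Q.
rewrite !subn0 subnn !expr0 mul1r mulr1 !mul1r; apply=> // p k pQ.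
rewrite -coefCM -/(minor x y); apply: (subspace_coef corrected0 correctedD correctedZ) => t.
rewrite horner_pencils -lin1D -lin2D.
(* The minor is unchanged when a multiple of y is added to x. *)
have -> : minor x y = minor (fun i => x i + t * y i) y :> S.
  by rewrite /minor lin1D lin2D -!mul_mpolyC; ring.
exact: corrected_minor.
Qed.

Let corrected_product s1 s2 : size s1 = P -> size s2 = Q ->
  corrected ((\prod_(x <- s1) lin1 x) * (\prod_(x <- s2) lin2 x)).
Proof.
move=> e1 e2; apply: (subspace_polarization corrected0 correctedD correctedZ) e1 => // x.
rewrite mulrC; apply: (subspace_polarization corrected0 correctedD correctedZ) e2 => // y.
by rewrite mulrC; apply: corrected_powers.
Qed.

Let monomial_prod (L : ('I_n.+1 -> K) -> S) (w : 'I_n.+1 -> nat) :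
  exists2 s : seq ('I_n.+1 -> K), size s = (\sum_i w i)%N &
    \prod_(x <- s) L x = \prod_i L (fun j => (j == i)%:R) ^+ w i.
Proof.
exists (flatten [seq nseq (w i) (fun j => (j == i)%:R) | i <- index_enum 'I_n.+1]).
  rewrite size_flatten /shape -map_comp sumnE big_map.
  by apply: eq_bigr => i _; rewrite /= size_nseq.
rewrite big_flatten big_map; apply: eq_bigr => i _.
by rewrite big_nseq iter_mulr_1.
Qed.

Lemma corrected_bihomogeneous f :
  (forall m : 'X_{1..n.+1 + n.+1}, m \in msupp f ->
     (\sum_i m (lshift n.+1 i) = r * A)%N /\ (\sum_i m (rshift n.+1 i) = r * B)%N) ->
  corrected f.
Proof.
move=> hf; rewrite [f]mpolyE big_seq.
apply: (subspace_sum corrected0 correctedD) => m /hf [h1 h2]; apply: correctedZ.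
rewrite mpolyXE_id big_split_ord /=.
have [s1 z1 e1] := monomial_prod (@lin1 K n) (fun i => m (lshift n.+1 i)).
have [s2 z2 e2] := monomial_prod (@lin2 K n) (fun i => m (rshift n.+1 i)).
have l1 i : lin1 (fun j => (j == i)%:R) = 'X_(lshift n.+1 i) :> S.
  rewrite /lin1 (bigD1 i) //= eqxx scale1r big1 ?addr0 // => j /negbTE->.
  by rewrite scale0r.
have l2 i : lin2 (fun j => (j == i)%:R) = 'X_(rshift n.+1 i) :> S.
  rewrite /lin2 (bigD1 i) //= eqxx scale1r big1 ?addr0 // => j /negbTE->.
  by rewrite scale0r.
under eq_bigr => i _ do rewrite -l1.
under [X in _ * X]eq_bigr => i _ do rewrite -l2.
by rewrite -e1 -e2; apply: corrected_product; rewrite ?z1 ?z2.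
Qed.

End Correction.

(** * Functions that are polynomial in each variable *)

Section PolynomialFunctions.
Variables (K : numFieldType) (N : nat).
Implicit Types (c : 'I_N -> K) (h : pred 'I_N) (f : ('I_N -> K) -> K).

Definition update c i t : 'I_N -> K := fun j => if j == i then t else c j.

Definition scale_on h t c : 'I_N -> K := fun j => if h j then t * c j else c j.

(** The uniform bound [D] permits interpolation at fixed nodes, one variable at a time. *)
Lemma separately_polynomial D f :
  (forall i c, exists2 p : {poly K}, (size p <= D)%N & forall t, f (update c i t) = p.[t]) ->
  exists F : {mpoly K[N]}, forall c, F.@[c] = f c.
Proof.
move=> fpol.
(* The first [k] variables are free, the others frozen at [c0]. *)
pose merge k c c0 : 'I_N -> K := fun j => if (j < k)%N then c j else c0 j.
suff /(_ N (fun=> 0)) [F FE] : forall k c0, exists F : {mpoly K[N]},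
    forall c, F.@[c] = f (merge k c c0).
  exists F => c; rewrite FE; congr f; apply: functional_extensionality => j.
  by rewrite /merge ltn_ord.
elim=> [|k IHk] c0.
  exists (f c0)%:MP => c; rewrite mevalC; congr f.
have [kN|Nk] := ltnP k N; last first.
  have [F FE] := IHk c0; exists F => c; rewrite FE; congr f.
  apply: functional_extensionality => j; rewrite /merge.
  by rewrite !(leq_trans (ltn_ord j)) // ltnW.
pose i := Ordinal kN.
have [G GE] : exists G : 'I_D -> {mpoly K[N]}, forall v c,
    (G v).@[c] = f (merge k c (update c0 i v%:R)).
  have : forall v : 'I_D, exists F : {mpoly K[N]},
      forall c, F.@[c] = f (merge k c (update c0 i v%:R)) by move=> v; apply: IHk.
  by move/fin_all_exists.
exists (\sum_v G v * \sum_(l < size (lagr K v)) (lagr K v)`_l *: 'X_i ^+ l) => c.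
have [p sp pE] := fpol i (merge k.+1 c c0).
have E : merge k.+1 c c0 = update (merge k.+1 c c0) i (c i).
  apply: functional_extensionality => j; rewrite /update; case: eqP => // ->.
  by rewrite /merge ltnS leqnn.
rewrite E pE (lagrange_interpolation sp) horner_sum raddf_sum.
apply: eq_bigr => v _ /=; rewrite hornerZ mevalM GE -pE; congr (f _ * _).
  apply: functional_extensionality => j; rewrite /merge /update.
  have [->|ji] := eqVneq j i; first by rewrite ltnn.
  have jk : (nat_of_ord j == k) = false.
    by apply: contraNF ji => /eqP e; apply/eqP/val_inj.
  by rewrite ltnS [(j <= k)%N]leq_eqVlt jk.
rewrite raddf_sum horner_coef; apply: eq_bigr => l _.
by rewrite /= mevalZ rmorphXn /= mevalXU.
Qed.

Lemma homogeneous_component h D (F : {mpoly K[N]}) :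
  (forall t c, t != 0 -> F.@[scale_on h t c] = t ^+ D * F.@[c]) ->
  exists F' : {mpoly K[N]}, (forall c, F'.@[c] = F.@[c]) /\
    (forall m, m \in msupp F' -> m \in msupp F /\ (\sum_(i | h i) m i = D)%N).
Proof.
move=> hF; pose w (m : 'X_{1..N}) := (\sum_(i | h i) m i)%N.
exists (\sum_(m <- msupp F | w m == D) F@_m *: 'X_[m]); split=> [c|k].
  pose p : {poly K} := \sum_(m <- msupp F) (F@_m * \prod_i c i ^+ m i) *: 'X^(w m).
  have pE : p = F.@[c] *: 'X^D.
    apply: poly_ext_neq0 => t t0; rewrite hornerZ hornerXn mulrC -hF // mevalE horner_sum.
    apply: eq_bigr => m _; rewrite hornerZ hornerXn -mulrA; congr (_ * _).
    rewrite /w expr_sum (bigID h) /= [in RHS](bigID h) /= mulrC mulrA -big_split /=.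
    congr (_ * _); apply: eq_bigr => i hi; last by rewrite /scale_on (negbTE hi).
    by rewrite /scale_on hi exprMn.
  have := congr1 (fun q : {poly K} => q`_D) pE; rewrite /p coef_sum coefZ coefXn eqxx mulr1 => <-.
  rewrite raddf_sum big_mkcond /=; apply: eq_bigr => m _; rewrite coefZ coefXn eq_sym.
  by case: eqP => _; rewrite ?mulr0 // mulr1 mevalZ mevalX.
rewrite mcoeff_msupp raddf_sum /= => nz.
have [/andP [kF /eqP wk]|H] := boolP ((k \in msupp F) && (w k == D)); first by split.
case/eqP: nz; rewrite big_seq_cond big1 // => m mF; rewrite mcoeffZ mcoeffX.
have [e|_] := eqVneq m k; last by rewrite mulr0.
by rewrite -e mF in H.
Qed.

(** Multiplication by t^(size q) makes the right-hand side t^D times a polynomial of degree at most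
    [size q]. This bounds a degree by the behaviour at infinity. *)
Lemma size_reciprocal (p q : {poly K}) D :
  (forall t, t != 0 -> p.[t] = t ^+ D * q.[t^-1]) -> (size p <= D.+1)%N.
Proof.
move=> pq; have [->|p0] := eqVneq p 0; first by rewrite size_poly0.
pose R : {poly K} := \sum_(i < size q) q`_i *: 'X^(size q - i).
have sR : (size R <= (size q).+1)%N.
  apply: (leq_trans (size_sum _ _ _)); apply/bigmax_leqP => i _.
  rewrite (leq_trans (size_scale_leq _ _)) // size_polyXn ltnS leq_subr //.
have E : p * 'X^(size q) = R * 'X^D.
  apply: poly_ext_neq0 => t t0; rewrite !hornerM !hornerXn pq // mulrAC -mulrA mulrC.
  congr (_ * _); rewrite horner_coef mulr_sumr horner_sum; apply: eq_bigr => i _.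
  rewrite hornerZ hornerXn exprVn mulrCA expfB_cond ?(negbTE t0) // add0n ltnW //.
have := congr1 (fun u : {poly K} => size u) E; rewrite size_Mmonic ?monicXn // size_polyXn addnS /=.
have [R0|R0] := eqVneq R 0.
  by rewrite R0 mul0r size_poly0 => /eqP; rewrite addn_eq0 size_poly_eq0 (negbTE p0).
rewrite size_Mmonic ?monicXn // size_polyXn addnS /= => e.
by rewrite -(leq_add2r (size q)) e addSn -addnS addnC leq_add2l.
Qed.

Lemma homogeneous_separately_polynomial h D f : (0 < D)%N ->
  let good c := [exists i, h i && (c i != 0)] && [exists i, ~~ h i && (c i != 0)] in
  (forall c, ~~ good c -> f c = 0) ->
  (forall t c, t != 0 -> f (scale_on h t c) = t ^+ D * f c) ->
  (forall c c', (forall t, good (fun i => c i + c' i * t)) ->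
     exists p : {poly K}, forall t, f (fun i => c i + c' i * t) = p.[t]) ->
  forall i c, h i ->
  exists2 p : {poly K}, (size p <= D.+1)%N & forall t, f (update c i t) = p.[t].
Proof.
move=> D0 good bad hom lin i c hi.
have [/existsP [j0 /andP [hj0 cj0]]|no] := boolP [exists j, ~~ h j && (c j != 0)]; last first.
  exists 0 => [|t]; first by rewrite size_poly0.
  rewrite horner0 bad // negb_and; apply/orP; right; apply: contra no => /existsP [j].
  rewrite /update; have [->|_] := eqVneq j i; first by rewrite hi.
  by move=> hj; apply/existsP; exists j.
have offi j : ~~ h j -> (j == i) = false by move=> hj; apply: contraNF hj => /eqP->.
have goodr (c1 : 'I_N -> K) : c1 j0 = c j0 -> [exists j, ~~ h j && (c1 j != 0)].
  by move=> e; apply/existsP; exists j0; rewrite hj0 e.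
have [/existsP [j /and3P [ji hj cj]]|no] := boolP [exists j, [&& j != i, h j & c j != 0]]; last first.
  have cz j : h j -> j != i -> c j = 0.
    move=> hj ji; apply/eqP; move: no; rewrite negb_exists => /forallP /(_ j).
    by rewrite ji hj /= negbK.
  (* The block [h] is supported at [i], so homogeneity gives a monomial; at [t = 0] both sides
     vanish because [D] is positive. *)
  exists (f (update c i 1) *: 'X^D).
    by rewrite (leq_trans (size_scale_leq _ _)) // size_polyXn.
  move=> t; rewrite hornerZ hornerXn; have [->|t0] := eqVneq t 0.
    rewrite expr0n gtn_eqF // mulr0 bad // negb_and; apply/orP; left.
    rewrite negb_exists; apply/forallP => j; rewrite negb_and negbK /update.
    have [->|ji] := eqVneq j i; first by rewrite eqxx orbT.
    by case: (boolP (h j)) => //= hj; rewrite cz.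
  rewrite mulrC -hom //; congr f; apply: functional_extensionality => j.
  rewrite /update /scale_on; have [->|ji] := eqVneq j i; first by rewrite hi mulr1.
  by case: ifP => // hj; rewrite cz // mulr0.
have [p pE] : exists p : {poly K}, forall t,
    f (fun l => update c i 0 l + (l == i)%:R * t) = p.[t].
  apply: lin => t; apply/andP; split.
    by apply/existsP; exists j; rewrite hj /update (negbTE ji) mul0r addr0.
  by apply: goodr; rewrite /update offi // mul0r addr0.
(* The same line seen from infinity: scaling the block by t at parameter 1/t gives back
   [update c i t]. *)
have [q qE] : exists q : {poly K}, forall t,
    f (fun l => (if h l then (l == i)%:R else c l) + (if h l then update c i 0 l else 0) * t) = q.[t].
  apply: lin => t; apply/andP; split.
    by apply/existsP; exists i; rewrite hi /update eqxx mul0r addr0 oner_eq0.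
  by apply: goodr; rewrite (negbTE hj0) mul0r addr0.
exists p.
  apply: (@size_reciprocal p q) => t t0; rewrite -pE -qE -hom //; congr f.
  apply: functional_extensionality => l; rewrite /scale_on /update.
  have [->|li] := eqVneq l i; first by rewrite hi mul0r addr0 mulr1 add0r mul1r.
  case: (boolP (h l)) => hl; rewrite /= mulr0n mul0r addr0.
    by rewrite add0r mulrCA divff // mulr1.
  by rewrite mul0r addr0.
move=> t; rewrite -pE; congr f; apply: functional_extensionality => l.
by rewrite /update; case: eqP => _; rewrite ?mul1r ?add0r // mul0r addr0.
Qed.

End PolynomialFunctions.

(** * Sections of the twisting sheaf *)

Section Sections.
Variables (K : numClosedFieldType) (n d e r : nat).
Hypotheses (e0 : (0 < e)%N) (ed : (2 * e < d)%N) (r3 : (3 <= r)%N).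

Let A := (d - e)%N.
Let dAe : d = (A + e)%N. Proof. by rewrite /A; lia. Qed.
Let eA : (e < A)%N. Proof. by rewrite /A; lia. Qed.

Notation S := {mpoly K[n.+1 + n.+1]}.
Notation X := (two_power_locus K n d e).
Notation phi := (form_coord K n d A e).
Implicit Types (a b : 'I_n.+1 -> K) (c : 'I_(n.+1 + n.+1) -> K).

Definition linear_form a : {mpoly K[n.+1]} := \sum_i a i *: 'X_i.

Definition two_power a b := form_coords d (linear_form a ^+ A * linear_form b ^+ e).

Lemma two_power_coord a b i : two_power a b ord0 i = (tnth phi i).@[point a b].
Proof.
rewrite mxE tnth_mktuple -mcoeff_map_mpoly; congr (_@_ _).
rewrite /generic_form rmorphM /= !rmorphXn /= !raddf_sum /=; congr (_ ^+ _ * _ ^+ _).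
  apply: eq_bigr => j _; rewrite rmorphM /= map_mpolyC map_mpolyX /= mevalXU.
  by rewrite point_l mul_mpolyC.
apply: eq_bigr => j _; rewrite rmorphM /= map_mpolyC map_mpolyX /= mevalXU.
by rewrite point_r mul_mpolyC.
Qed.

Lemma heval_two_power T a b : heval T (two_power a b) = (T \mPo phi).@[point a b].
Proof.
by rewrite comp_mpoly_meval; apply: meval_eq => i; apply: two_power_coord.
Qed.

Lemma linear_form_homog a : linear_form a \is 1.-homog.
Proof.
by apply: rpred_sum => i _; rewrite dhomogZ // dhomogX; apply/eqP/mdeg1.
Qed.

Lemma linear_formE (L : {mpoly K[n.+1]}) : L \is 1.-homog ->
  L = linear_form (fun i => L@_U_(i)).
Proof.
move=> hL; apply/mpolyP => m; rewrite /linear_form raddf_sum /=.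
have [/mdeg1P [i /eqP ->]|m1] := boolP (mdeg m == 1%N).
  rewrite (bigD1 i) //= big1; first by rewrite mcoeffZ mcoeffXU eqxx mulr1 addr0.
  by move=> j /negbTE ji; rewrite mcoeffZ mcoeffXU ji mulr0.
rewrite (dhomog_nemf_coeff hL m1) big1 // => i _; rewrite mcoeffZ mcoeffX.
by case: eqP => [mi|_]; [rewrite -mi mdeg1 in m1 | rewrite mulr0].
Qed.

Lemma linear_form_neq0 a : [exists i, a i != 0] -> linear_form a != 0.
Proof.
move=> /existsP [k]; apply: contraNneq => a0.
have := congr1 (mcoeff U_(k)) a0; rewrite mcoeff0 /linear_form raddf_sum /=.
rewrite (bigD1 k) //= big1 ?addr0; first by rewrite mcoeffZ mcoeffXU eqxx mulr1 => ->.
by move=> j /negbTE ji; rewrite mcoeffZ mcoeffXU ji mulr0.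
Qed.

Lemma two_power_neq0 a b : [exists i, a i != 0] -> [exists i, b i != 0] ->
  two_power a b != 0.
Proof.
move=> a0 b0; set F := linear_form a ^+ A * linear_form b ^+ e.
have F0 : F != 0 by rewrite mulf_neq0 // expf_neq0 // linear_form_neq0.
have hF : F \is d.-homog.
  by rewrite dAe -(mul1n A) -(mul1n e); apply: dhomogM; apply: dhomogMn; apply: linear_form_homog.
have mF := mlead_supp F0; have := dhomog_mf hF mF => /eqP md.
have mi : mlead F \in form_monomials n d by rewrite /form_monomials -basis_cover.
have im : (index (mlead F) (form_monomials n d) < (formsN n d).+1)%N.
  by rewrite -size_form_monomials index_mem.
apply: contraTneq mF => z; rewrite mcoeff_msupp negbK.
have := congr1 (fun v : 'rV_(formsN n d).+1 => v ord0 (Ordinal im)) z.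
by rewrite !mxE /= nth_index // => ->.
Qed.

Lemma two_power_in a b : [exists i, a i != 0] -> [exists i, b i != 0] -> X (two_power a b).
Proof.
move=> a0 b0; split; first exact: two_power_neq0.
exists (linear_form a), (linear_form b), 1.
by split; rewrite ?linear_form_homog // scale1r.
Qed.

Lemma two_powerZ a b t u :
  two_power (fun i => t * a i) (fun i => u * b i) = (t ^+ A * u ^+ e) *: two_power a b.
Proof.
have E k (x : 'I_n.+1 -> K) : linear_form (fun i => k * x i) = k *: linear_form x.
  by rewrite /linear_form scaler_sumr; apply: eq_bigr => i _; rewrite scalerA.
apply/rowP => i; rewrite !mxE !E !exprZn -scalerAl -scalerAr scalerA mcoeffZ.
by [].
Qed.

Variable s : 'rV[K]_(formsN n d).+1 -> K.
Hypothesis sX : twisted_section X r s.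

Definition left_part c : 'I_n.+1 -> K := fun i => c (lshift n.+1 i).
Definition right_part c : 'I_n.+1 -> K := fun i => c (rshift n.+1 i).

Lemma point_parts c : point (left_part c) (right_part c) = c.
Proof.
apply: functional_extensionality => i; rewrite /point /left_part /right_part.
by case: splitP => j h; congr c; apply: val_inj.
Qed.

Lemma left_part_point a b : left_part (point a b) = a.
Proof. by apply: functional_extensionality => i; apply: point_l. Qed.

Lemma right_part_point a b : right_part (point a b) = b.
Proof. by apply: functional_extensionality => i; apply: point_r. Qed.

Let nonzero a := [exists i, a i != 0].
Let good c := nonzero (left_part c) && nonzero (right_part c).

(* The junk value on the locus where a factor vanishes is the one making the
   pullback homogeneous, hence polynomial, everywhere. *)
Definition pullback c : K :=
  if good c then s (two_power (left_part c) (right_part c)) else 0.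

Let on_left : pred 'I_(n.+1 + n.+1) := fun i => (i < n.+1)%N.
Let on_right : pred 'I_(n.+1 + n.+1) := fun i => ~~ on_left i.

Let on_left_l i : on_left (lshift n.+1 i).
Proof. by rewrite /on_left /=. Qed.

Let on_left_r i : on_left (rshift n.+1 i) = false.
Proof. by rewrite /on_left /= ltnNge leq_addr. Qed.

Let goodE c : good c =
  [exists i, on_left i && (c i != 0)] && [exists i, ~~ on_left i && (c i != 0)].
Proof.
congr (_ && _); apply/existsP/existsP => -[i +].
- by move=> ci; exists (lshift n.+1 i); rewrite on_left_l.
- move=> /andP [hi ci]; exists (Ordinal (hi : (i < n.+1)%N)).
  by rewrite /left_part (_ : lshift _ _ = i) //; apply: val_inj.
- by move=> ci; exists (rshift n.+1 i); rewrite on_left_r.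
- move=> /andP [hi ci]; have hi' : (i - n.+1 < n.+1)%N.
    by move: hi (ltn_ord i); rewrite /on_left; lia.
  exists (Ordinal hi'); rewrite /right_part (_ : rshift _ _ = i) //; apply: val_inj => /=.
  by move: hi; rewrite /on_left; lia.
Qed.

Let scale_left t c : scale_on on_left t c = point (fun i => t * left_part c i) (right_part c).
Proof.
rewrite -[LHS]point_parts; congr point; apply: functional_extensionality => i.
  by rewrite /left_part /scale_on on_left_l.
by rewrite /right_part /scale_on on_left_r.
Qed.

Let scale_right t c : scale_on on_right t c = point (left_part c) (fun i => t * right_part c i).
Proof.
rewrite -[LHS]point_parts; congr point; apply: functional_extensionality => i.
  by rewrite /left_part /scale_on /on_right on_left_l.
by rewrite /right_part /scale_on /on_right on_left_r.
Qed.

Let nonzeroZ t a : t != 0 -> nonzero (fun i => t * a i) = nonzero a.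
Proof. by move=> t0; apply: eq_existsb => i; rewrite mulf_eq0 (negbTE t0). Qed.

Lemma pullback_left t c : t != 0 ->
  pullback (scale_on on_left t c) = t ^+ (r * A) * pullback c.
Proof.
move=> t0; rewrite scale_left /pullback /good !left_part_point !right_part_point nonzeroZ //.
case: ifP => [/andP [h1 h2]|_]; last by rewrite mulr0.
have -> : two_power (fun i => t * left_part c i) (right_part c) =
    t ^+ A *: two_power (left_part c) (right_part c).
  have := two_powerZ (left_part c) (right_part c) t 1.
  rewrite expr1n mulr1 => <-; congr two_power.
  by apply: functional_extensionality => i; rewrite mul1r.
by have [-> //] := sX; rewrite ?expf_neq0 // -?exprM 1?mulnC //; apply: two_power_in.
Qed.

Lemma pullback_right t c : t != 0 ->
  pullback (scale_on on_right t c) = t ^+ (r * e) * pullback c.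
Proof.
move=> t0; rewrite scale_right /pullback /good !left_part_point !right_part_point nonzeroZ //.
case: ifP => [/andP [h1 h2]|_]; last by rewrite mulr0.
have -> : two_power (left_part c) (fun i => t * right_part c i) =
    t ^+ e *: two_power (left_part c) (right_part c).
  have := two_powerZ (left_part c) (right_part c) 1 t.
  rewrite expr1n mul1r => <-; congr two_power.
  by apply: functional_extensionality => i; rewrite mul1r.
by have [-> //] := sX; rewrite ?expf_neq0 // -?exprM 1?mulnC //; apply: two_power_in.
Qed.

(** Numerator and denominator are recorded as restricted forms because their derivatives along the
    diagonal are needed later. *)
Lemma pullback_local c0 : good c0 -> exists Z G H : S,
  [/\ Z.@[c0] != 0, exists k, restricted d A e k G, exists k, restricted d A e k H &
   forall c, Z.@[c] != 0 -> H.@[c] != 0 /\ pullback c * H.@[c] = G.@[c]].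
Proof.
move=> /[dup] g0 /andP [/[dup] hl /existsP [i hi] /[dup] hr /existsP [j hj]].
have [_ /(_ _ (two_power_in hl hr))] := sX.
move=> [U [[E [_ UE]] Up [k [G [H [hG hH GH]]]]]].
have p0 := two_power_neq0 hl hr.
have [P EP P0] := (UE _ p0).1 Up.
(* The two coordinates, nonzero at [c0], keep both factors nonzero wherever [Z] is. *)
exists ((P \mPo phi) * ('X_(lshift n.+1 i) * 'X_(rshift n.+1 j))), (G \mPo phi), (H \mPo phi).
split.
- rewrite !mevalM !mevalXU !mulf_neq0 //.
  by rewrite -[c0]point_parts -heval_two_power.
- by exists (k + r)%N; exists G.
- by exists k; exists H.
move=> c; rewrite !mevalM !mevalXU !mulf_eq0 !negb_or => /and3P [Pc ci cj].
have hlc : nonzero (left_part c) by apply/existsP; exists i.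
have hrc : nonzero (right_part c) by apply/existsP; exists j.
have Uc : U (two_power (left_part c) (right_part c)).
  apply/UE; first exact: two_power_neq0.
  exists P; first exact: EP.
  by rewrite heval_two_power point_parts.
have [] := GH _ (two_power_in hlc hrc) Uc; rewrite !heval_two_power point_parts => Hc sc.
split; first exact: Hc.
by rewrite /pullback /good hlc hrc /= sc divfK.
Qed.

Lemma pullback_on_line c c' : (forall t, good (fun i => c i + c' i * t)) ->
  exists p : {poly K}, forall t, pullback (fun i => c i + c' i * t) = p.[t].
Proof.
move=> hg; apply: locally_rational_polynomial => t0.
have [Z [G [H [Z0 _ _ ZGH]]]] := pullback_local (hg t0).
exists (on_line c c' Z), (on_line c c' G), (on_line c c' H).
rewrite !on_lineE; split=> // t; rewrite !on_lineE; exact: ZGH.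
Qed.

Lemma pullback_polynomial : exists f : S, [/\ forall c, f.@[c] = pullback c &
  forall m : 'X_{1..n.+1 + n.+1}, m \in msupp f ->
    (\sum_i m (lshift n.+1 i) = r * A)%N /\ (\sum_i m (rshift n.+1 i) = r * e)%N].
Proof.
have rA0 : (0 < r * A)%N by nia.
have re0 : (0 < r * e)%N by nia.
have [f0 f0E] : exists f : S, forall c, f.@[c] = pullback c.
  apply: (@separately_polynomial _ _ (maxn (r * A) (r * e)).+1) => i c.
  have [hi|hi] := boolP (on_left i).
    have [|t c1 t0|c1 c1' h1|p sp pE] :=
      @homogeneous_separately_polynomial _ _ on_left (r * A) pullback rA0 _ _ _ i c hi.
    - by move=> c1; rewrite -goodE /pullback => /negbTE->.
    - exact: pullback_left.
    - by apply: pullback_on_line => t; rewrite goodE.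
    by exists p => //; rewrite (leq_trans sp) // ltnS leq_maxl.
  have [|t c1 t0|c1 c1' h1|p sp pE] :=
    @homogeneous_separately_polynomial _ _ on_right (r * e) pullback re0 _ _ _ i c hi.
  - move=> c1 h1; rewrite /pullback ifN // goodE; apply: contra h1 => /andP [h1 h2].
    rewrite h2; apply/existsP; case/existsP: h1 => l hl; exists l.
    by rewrite /on_right negbK.
  - exact: pullback_right.
  - apply: pullback_on_line => t; rewrite goodE; have /andP [h2 h3] := h1 t.
    rewrite h2 andbT; case/existsP: h3 => l hl; apply/existsP; exists l.
    by rewrite /on_right negbK in hl.
  by exists p => //; rewrite (leq_trans sp) // ltnS leq_maxr.
have [t c t0|f1 [f1E f1m]] := @homogeneous_component _ _ on_left (r * A) f0.
  by rewrite !f0E pullback_left.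
have [t c t0|f2 [f2E f2m]] := @homogeneous_component _ _ on_right (r * e) f1.
  by rewrite !f1E !f0E pullback_right.
exists f2; split=> [c|m /f2m [/f1m [_ <-] <-]]; first by rewrite f2E f1E f0E.
split; rewrite big_split_ord /=.
  rewrite [X in _ = (_ + X)%N]big1 ?addn0; last by move=> i; rewrite on_left_r.
  by apply: eq_bigl => i; rewrite on_left_l.
rewrite [X in _ = (X + _)%N]big1 ?add0n; last by move=> i; rewrite /on_right on_left_l.
by apply: eq_bigl => i; rewrite /on_right on_left_r.
Qed.

Lemma pullback_diag_deriv (f : S) (c m : 'I_n.+1 -> K) :
  (forall c', f.@[c'] = pullback c') -> diag_deriv A e c m f = 0.
Proof.
move=> fE; have [c0|/existsPn c0] := boolP (nonzero c).
  have g0 : good (point c c) by rewrite /good left_part_point right_part_point c0.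
  have [Z [G [H [Z0 [k rG] [l rH] ZGH]]]] := pullback_local g0.
  set L := diag_line A e c m.
  have LE g t : (L g).[t] = g.@[fun i => point c c i +
      point (fun i => e%:R * m i) (fun i => - A%:R * m i) i * t] by apply: on_lineE.
  have at0 g : (L g).[0] = g.@[point c c].
    by rewrite LE; apply: meval_eq => i; rewrite mulr0 addr0.
  have LZ : L Z != 0 by apply: contraNneq Z0 => h; rewrite -at0 h horner0.
  have E : L f * L H = L G.
    apply: (poly_eq_off_roots LZ) => t; rewrite hornerM !LE => /ZGH [_ <-].
    by rewrite fE.
  (* Neither [L G] nor [L H] has a linear term, and [L H] has a nonzero constant term, so the linear
     coefficient of [L f] vanishes. *)
  have := congr1 (fun p : {poly K} => p`_1) E.
  have dG : (L G)`_1 = 0 := diag_deriv_restricted c m rG.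
  have dH : (L H)`_1 = 0 := diag_deriv_restricted c m rH.
  rewrite coefM !big_ord_recr big_ord0 /= dG dH mulr0 !add0r => /eqP.
  have H0 : (L H)`_0 != 0.
    by rewrite -horner_coef0 at0; have [] := ZGH _ Z0.
  by rewrite mulf_eq0 (negbTE H0) orbF => /eqP.
(* For [c = 0] the pullback has its default value at the diagonal point; bihomogeneity makes the
   restriction to the line a monomial of degree above 1. *)
pose v := point (fun i => e%:R * m i) (fun i => - A%:R * m i).
have E : diag_line A e c m f = f.@[v] *: 'X^(r * A + r * e).
  apply: poly_ext_neq0 => t t0; rewrite /diag_line on_lineE hornerZ hornerXn.
  have cz i : c i = 0 by have := c0 i; rewrite negbK => /eqP.
  have -> : (fun i => point c c i + v i * t) = scale_on on_left t (scale_on on_right t v).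
    apply: functional_extensionality => i; rewrite /scale_on /on_right.
    have -> : point c c i = 0 by rewrite /point; case: split => j; apply: cz.
    by case: (on_left i); rewrite /= add0r mulrC.
  by rewrite !fE pullback_left // pullback_right // mulrA -exprD mulrC.
rewrite /diag_deriv E coefZ coefXn (_ : (1 == r * A + r * e)%N = false) ?mulr0 //.
by apply/negbTE; nia.
Qed.

Lemma section_extends : exists t, twisted_section (@pspace K (formsN n d)) r t /\
  (forall v, X v -> t v = s v).
Proof.
have [f [fE fm]] := pullback_polynomial.
have [F [T hT FE] fF] := corrected_bihomogeneous dAe e0 eA r3 fm.
have TE a b : heval T (two_power a b) = pullback (point a b).
  (* The correction of [f] is zero, since all its derivatives along the diagonal vanish; hence [f]
     itself is restricted. *)
  rewrite heval_two_power -FE -fF -fE /diag_average big1 ?mulr0 ?addr0 // => k _.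
  by rewrite pullback_diag_deriv ?mulr0.
have hevalZ (k : K) v : heval T (k *: v) = k ^+ r * heval T v.
  rewrite /heval !mevalE big_seq [in RHS]big_seq mulr_sumr; apply: eq_bigr => m mT.
  have <- := dhomog_mf hT mT; rewrite mulrCA /= mdegE expr_sum -big_split /=.
  by congr (_ * _); apply: eq_bigr => i _; rewrite mxE exprMn.
exists (heval T); split.
  split=> [k v _ _|p _]; first exact: hevalZ.
  exists (fun=> True); split=> //.
    exists (fun P => P = 1); split=> [P ->|v _]; first by exists 0%N; apply: dhomog1.
    by split=> // _; exists 1 => //; rewrite /heval meval1 oner_eq0.
  exists 0%N, T, 1; split; rewrite ?dhomog1 // => q _ _.
  by rewrite /heval meval1 oner_eq0 divr1.
move=> v [v0 [L1 [L2 [k [h1 h2 vE]]]]].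
have E : v = k *: two_power (fun i => L1@_U_(i)) (fun i => L2@_U_(i)).
  by rewrite vE /two_power -!linear_formE.
have k0 : k != 0 by apply: contraNneq v0 => h; rewrite E h scale0r.
have two0 : two_power (fun i => L1@_U_(i)) (fun i => L2@_U_(i)) != 0.
  by apply: contraNneq v0 => h; rewrite E h scaler0.
have zero_form (L : {mpoly K[n.+1]}) : L \is 1.-homog -> ~~ nonzero (fun i => L@_U_(i)) -> L = 0.
  move=> hL /existsPn z; rewrite (linear_formE hL) /linear_form big1 // => i _.
  by have := z i; rewrite negbK => /eqP->; rewrite scale0r.
have coords0 : form_coords d (0 : {mpoly K[n.+1]}) = 0.
  by apply/rowP => i; rewrite !mxE mcoeff0.
have A0 : A != 0%N by lia.
(* As [v] is nonzero, neither linear form vanishes, so the pullback takes a value of [s] and not the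
   default 0. *)
have n1 : nonzero (fun i => L1@_U_(i)).
  apply: contraNT two0 => /(zero_form _ h1) z; apply/eqP.
  by rewrite /two_power -!linear_formE // z expr0n (negbTE A0) mul0r coords0.
have n2 : nonzero (fun i => L2@_U_(i)).
  apply: contraNT two0 => /(zero_form _ h2) z; apply/eqP.
  by rewrite /two_power -!linear_formE // z expr0n (gtn_eqF e0) mulr0 coords0.
rewrite E hevalZ TE /pullback /good left_part_point right_part_point n1 n2 /=.
by have [-> //] := sX; apply: two_power_in.
Qed.

End Sections.

Local Close Scope ring_scope.

Theorem proposition1p2 (R : realType) (n d e r : nat) :
  1 <= n -> 1 <= e -> 2 * e < d -> 3 <= r ->
  r_normal (two_power_locus (complex R) n d e) r.
Proof. by move=> _ e0 ed r3 s; apply: section_extends. Qed.
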